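(* Let $\{\theta_k\}$ be generated by $\theta_{k+1}=\theta_k+\alpha_k(F(X_k,\theta_k)+w_k)$ from $\theta_0\in\mathbb{R}^d$. Suppose that the assumptions (A1), (A2), (A3) in the context are satisfied and that the stepsize sequence $\{\alpha_k\}$ satisfies: (1) $\{\alpha_k\}$ is non-increasing and $\alpha_0\in(0,1)$; (2) $\alpha_{k-t_k,k-1}<\frac{c_0}{130L^2}$ for all $k\ge t_k$. Let $K=\min\{k: k\ge t_k\}$. Then for all $k\ge K$, $$\mathbb{E}[\|\theta_k-\theta^*\|^2]\le \beta_1\prod_{j=K}^{k-1}(1-c_0\alpha_j)+\beta_2\sum_{i=K}^{k-1}\hat\alpha_i\prod_{j=i+1}^{k-1}(1-c_0\alpha_j),$$ where $\beta_1=(\|\theta_0\|+\|\theta_0-\theta^*\|+1)^2$, $\beta_2=130L^2(\|\theta^*\|+1)^2$, and $\hat\alpha_i=\alpha_i\,\alpha_{i-t_i,i-1}$.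
   Context: $\|\cdot\|$ is the Euclidean norm. $\mathcal{X}\subseteq\mathbb{R}^{n_X}$, $F:\mathcal{X}\times\mathbb{R}^d\to\mathbb{R}^d$ is a general nonlinear operator, $\{X_k\}_{k\ge0}$ is a Markov chain on $\mathcal{X}$ with transition kernel $P$ and stationary distribution $\mu_X$, and $\bar F(\theta)=\mathbb{E}_{X\sim\mu_X}[F(X,\theta)]$. The initial point $\theta_0\in\mathbb{R}^d$ is given, $\{\alpha_k\}$ is a sequence of (positive) stepsizes, and $\{w_k\}$ is an $\mathbb{R}^d$-valued noise sequence (possibly depending on $\{\theta_k\}$). $\mathcal{F}_k$ is the $\sigma$-algebra generated by $\{\theta_i,X_i,w_i\}_{0\le i\le k-1}\cup\{\theta_k,X_k\}$. $\|\cdot\|_{\mathrm{TV}}$ is the total variation distance ($\sup_A|\mu(A)-\nu(A)|$). (A1) There is a constant $L_1>0$ such that $\|F(x,\theta_1)-F(x,\theta_2)\|\le L_1\|\theta_1-\theta_2\|$ for all $\theta_1,\theta_2,x$, and $\|F(x,0)\|\le L_1$ for all $x$. (A2) The equation $\bar F(\theta)=0$ has a unique solution, denoted $\theta^*$, and there is $c_0>0$ such that $(\theta-\theta^* )^\top\bar F(\theta)\le -c_0\|\theta-\theta^*\|^2$ for all $\theta\in\mathbb{R}^d$. (A3) (1) $\{X_k\}$ is uniformly geometrically ergodic with unique stationary distribution $\mu_X$: there are $C\ge1$ and $\rho\in(0,1)$ with $\sup_{x\in\mathcal{X}}\|P^k(x,\cdot)-\mu_X(\cdot)\|_{\mathrm{TV}}\le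 C\rho^k$ for all $k\ge0$. (2) $\mathbb{E}[w_k\mid\mathcal{F}_k]=0$ and $\|w_k\|\le L_2(\|\theta_k\|+1)$ for all $k\ge0$, where $L_2>0$ is a constant. Notation: $L=L_1+L_2$, and it is assumed without loss of generality that $L\ge1$. For $\delta>0$ the mixing time of $\{X_k\}$ with precision $\delta$ is $t_\delta=\min\{k\ge0:\sup_{x\in\mathcal{X}}\|P^k(x,\cdot)-\mu_X(\cdot)\|_{\mathrm{TV}}\le\delta\}$; $t_k:=t_{\alpha_k}$; $\alpha_{i,j}:=\sum_{l=i}^{j}\alpha_l$.
   Formalization: Adds t_0 ≥ 1 (the mixing time at precision α_0 is nonzero, so K ≥ 1) and d ≥ 1; with t_0 = 0 the sums α_{k-t_k,k-1} can be empty and the bound fails (one-point chain, F=-θ, w=±1, α=1/2, θ_0=0). The Markov property is taken with respect to F_k. *)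

(* Defs.v *)
From HB Require Import structures.
From mathcomp Require Import all_boot all_order all_algebra.
From mathcomp Require Import all_classical all_reals all_analysis.

Set Implicit Arguments.
Unset Strict Implicit.
Unset Printing Implicit Defensive.

Import Order.TTheory GRing.Theory Num.Theory.
Import numFieldNormedType.Exports.

Local Open Scope classical_set_scope.
Local Open Scope ring_scope.

(* The norm that MathComp-Analysis puts on 'rV[R]_n is the sup norm, hence a
   separate definition. *)
Definition norm2 (R : realType) (n : nat) (v : 'rV[R]_n) : R :=
  Num.sqrt (\sum_i v 0 i ^+ 2).

Definition dotv (R : realType) (n : nat) (u v : 'rV[R]_n) : R :=
  \sum_i u 0 i * v 0 i.

(* The Borel sigma-algebra of R^n, presented as the product sigma-algebra, i.e.
   generated by the preimages of Borel sets of R under the coordinates. *)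
Definition rV_cylinders (R : realType) (n : nat) : set (set 'rV[R]_n) :=
  \bigcup_(i in [set: 'I_n])
    preimage_set_system setT (fun v : 'rV[R]_n => v 0 i) measurable.
Arguments rV_cylinders : clear implicits.

HB.instance Definition _ (R : realType) (n : nat) :=
  @isMeasurable.Build (sigma_display (rV_cylinders R n)) 'rV[R]_n
    <<s rV_cylinders R n >>
    (@sigma_algebra0 _ setT (rV_cylinders R n))
    (@sigma_algebraC _ (rV_cylinders R n))
    (@sigma_algebra_bigcup _ setT (rV_cylinders R n)).

(* A nonempty subset X of R^n with the trace of the Borel sigma-algebra. The
   library's measurable types are pointed: x0 only witnesses X <> set0. *)
Definition state (R : realType) (n : nat) (X : set 'rV[R]_n) (x0 : X) : Type :=
  X.

Section state_instances.
Context (R : realType) (n : nat) (X : set 'rV[R]_n) (x0 : X).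

HB.instance Definition _ := Choice.copy (state x0) (set_type X).
HB.instance Definition _ := isPointed.Build (state x0) x0.

Definition state_val (x : state x0) : 'rV[R]_n := val (x : set_type X).

HB.instance Definition _ :=
  Measurable.copy (state x0) (g_sigma_algebra_preimageType state_val).

End state_instances.

Section conditional_expectation.
Context (d : measure_display) (T : measurableType d) (R : realType).
Variable Pr : probability T R.

(* Z is a version of E[Y | G], for G a sub-sigma-algebra of T. *)
Definition is_cond_exp (G : set (set T)) (Y Z : T -> R) : Prop :=
  [/\ forall B : set R, measurable B -> G (Z @^-1` B),
      Pr.-integrable setT (EFin \o Y),
      Pr.-integrable setT (EFin \o Z)
    & forall A, G A -> (\int[Pr]_(t in A) (Z t)%:E = \int[Pr]_(t in A) (Y t)%:E)%E].

Definition is_cond_exp_rV (n : nat) (G : set (set T)) (Y Z : T -> 'rV[R]_n) :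
    Prop :=
  forall i, is_cond_exp G (fun t => Y t 0 i) (fun t => Z t 0 i).

End conditional_expectation.

Section markov.
Context (dS : measure_display) (S : measurableType dS) (R : realType).
Variable P : R.-pker S ~> S.

Fixpoint kpow (k : nat) : R.-spker S ~> S :=
  if k is m.+1 then mkcomp_noparam (kpow m) P
  else kdirac (@measurable_id _ S setT).

Definition stationary (mu : probability S R) : Prop :=
  forall A, measurable A -> (\int[mu]_x P x A = mu A)%E.

Definition unique_stationary (mu : probability S R) : Prop :=
  stationary mu /\
  forall nu : probability S R, stationary nu ->
    forall A, measurable A -> nu A = mu A.

Definition tv_dist (mu nu : set S -> \bar R) : \bar R :=
  ereal_sup [set `|mu A - nu A|%E | A in measurable].

Definition sup_tv (mu : probability S R) (k : nat) : \bar R :=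
  ereal_sup [set tv_dist (kpow k x) mu | x in setT].

Context (dO : measure_display) (Omega : measurableType dO).
Variable Pr : probability Omega R.

Definition markov_chain (G : nat -> set (set Omega)) (X : nat -> Omega -> S) :
    Prop :=
  forall k (A : set S), measurable A ->
    is_cond_exp Pr (G k) (\1_(X k.+1 @^-1` A)) (fun om => fine (P (X k om) A)).

End markov.

Definition is_least (A : set nat) (k : nat) : Prop :=
  A k /\ forall m, A m -> (k <= m)%N.

(* 0 if no power of P is delta-close to mu; under geometric ergodicity this
   never happens for delta > 0. *)
Definition mixing_time (dS : measure_display) (S : measurableType dS)
    (R : realType) (P : R.-pker S ~> S) (mu : probability S R) (delta : R) :
    nat :=
  xget 0%N (is_least [set k | (sup_tv P mu k <= delta%:E)%E]).

Definition mean_field (dS : measure_display) (S : measurableType dS)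
    (R : realType) (d : nat) (mu : probability S R)
    (F : S -> 'rV[R]_d -> 'rV[R]_d) (theta : 'rV[R]_d) : 'rV[R]_d :=
  \row_i fine ('E_mu[fun x => (F x theta 0 i)%R])%E.

(* sigma({theta_i, X_i, w_i : i < k} U {theta_k, X_k}) *)
Definition history (dO : measure_display) (Omega : measurableType dO)
    (dS : measure_display) (S : measurableType dS) (R : realType) (d : nat)
    (theta : nat -> Omega -> 'rV[R]_d) (X : nat -> Omega -> S)
    (w : nat -> Omega -> 'rV[R]_d) (k : nat) : set (set Omega) :=
  <<s (\bigcup_(i in [set i | (i <= k)%N])
         (preimage_set_system setT (theta i) measurable `|`
          preimage_set_system setT (X i) measurable)) `|`
      (\bigcup_(i in [set i | (i < k)%N])
         preimage_set_system setT (w i) measurable) >>.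

(* alpha_{k - t_k, k - 1}: the t_k stepsizes preceding time k, an empty sum when
   t_k = 0. If t_k > k the subtraction truncates and the sum starts at 0. *)
Definition alpha_window (R : realType) (alpha : nat -> R) (t : nat -> nat)
    (k : nat) : R :=
  \sum_(k - t k <= l < k) alpha l.

(* Main.v *)
Require Import Defs.
From HB Require Import structures.
From mathcomp Require Import all_boot all_order all_algebra.
From mathcomp Require Import all_classical all_reals all_analysis.
From mathcomp Require Import measurable_realfun.
From mathcomp Require Import ring lra.

(* Expanding the squared error at time k, the drift contributes
   - 2 c0 alpha_k |theta_k - theta^*|^2 and the martingale noise contributes
   nothing in the mean. The bias of the Markovian noise at theta_k is compared
   with its value at theta_{k - s}, s being a mixing lag: the iterates move by
   O(alpha_{k-s,k-1}) over the lag, and given the past at time k - s the state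
   X_k is delta-close to stationarity in total variation. All the remainders
   are O(L^2 alpha_k alpha_{k-s,k-1}) (|theta_k - theta^*|^2 + (|theta^*| + 1)^2),
   of which the first part is absorbed by half of the drift.

   No conditional expectation is integrated against the joint law of
   (theta_{k-s}, X_k): theta_{k-s} is discretised on a fine grid, so that only
   its cells, which are events of the past, and frozen parameters occur.

   Since K only is the first k with t_k <= k, it may happen that t_k > k for
   some k > K; then the lag s = K = t_K is used. *)

Set Implicit Arguments.
Unset Strict Implicit.
Unset Printing Implicit Defensive.

Import Order.TTheory GRing.Theory Num.Theory.
Import numFieldNormedType.Exports.

Local Open Scope classical_set_scope.
Local Open Scope ring_scope.

(** * Euclidean norm *)

Section euclidean.
Context (R : realType) (n : nat).
Implicit Types u v x y : 'rV[R]_n.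

Lemma dotvC u v : dotv u v = dotv v u.
Proof. by apply: eq_bigr => i _; rewrite mulrC. Qed.

Lemma dotvDl u x y : dotv (x + y) u = dotv x u + dotv y u.
Proof. by rewrite -big_split; apply: eq_bigr => i _; rewrite mxE mulrDl. Qed.

Lemma dotvDr u x y : dotv u (x + y) = dotv u x + dotv u y.
Proof. by rewrite dotvC dotvDl !(dotvC _ u). Qed.

Lemma dotvZl a u v : dotv (a *: u) v = a * dotv u v.
Proof. by rewrite mulr_sumr; apply: eq_bigr => i _; rewrite mxE mulrA. Qed.

Lemma dotvZr a u v : dotv u (a *: v) = a * dotv u v.
Proof. by rewrite dotvC dotvZl dotvC. Qed.

Lemma dotvNl u v : dotv (- u) v = - dotv u v.
Proof. by rewrite -scaleN1r dotvZl mulN1r. Qed.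

Lemma dotvNr u v : dotv u (- v) = - dotv u v.
Proof. by rewrite dotvC dotvNl dotvC. Qed.

Lemma dotvBl u x y : dotv (x - y) u = dotv x u - dotv y u.
Proof. by rewrite dotvDl dotvNl. Qed.

Lemma dotvBr u x y : dotv u (x - y) = dotv u x - dotv u y.
Proof. by rewrite dotvDr dotvNr. Qed.

Lemma norm2_ge0 u : 0 <= norm2 u.
Proof. exact: sqrtr_ge0. Qed.

Lemma norm2_sqr u : norm2 u ^+ 2 = dotv u u.
Proof.
rewrite /norm2 sqr_sqrtr; last by apply: sumr_ge0 => i _; exact: sqr_ge0.
by apply: eq_bigr => i _; rewrite expr2.
Qed.

Lemma norm2_coord u i : `|u 0 i| <= norm2 u.
Proof.
rewrite -(@ler_pXn2r _ 2)// ?nnegrE ?norm2_ge0//.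
rewrite norm2_sqr real_normK ?num_real// /dotv (bigD1 i)//= -expr2 lerDl.
by apply: sumr_ge0 => j _; rewrite -expr2 sqr_ge0.
Qed.

Lemma norm2_eq0 u : norm2 u = 0 -> u = 0.
Proof.
move=> u0; apply/rowP => i; rewrite mxE; apply/eqP.
by rewrite -normr_le0 -u0 norm2_coord.
Qed.

Lemma dot0v u : dotv 0 u = 0.
Proof. by rewrite -(scale0r u) dotvZl mul0r. Qed.

Lemma dotv0 u : dotv u 0 = 0.
Proof. by rewrite dotvC dot0v. Qed.

Lemma norm2_0 : norm2 (0 : 'rV[R]_n) = 0.
Proof. by apply/eqP; rewrite -sqrf_eq0 norm2_sqr dot0v. Qed.

(** Cauchy-Schwarz: expand the square of the norm of [norm2 v *: u - norm2 u *: v] and divide by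
    [norm2 u * norm2 v]; zero vectors are set apart to allow the division. *)
Lemma dotv_le u v : dotv u v <= norm2 u * norm2 v.
Proof.
have [->|/eqP u0] := eqVneq u 0; first by rewrite dot0v mulr_ge0 ?norm2_ge0.
have [->|/eqP v0] := eqVneq v 0; first by rewrite dotv0 mulr_ge0 ?norm2_ge0.
have pu : 0 < norm2 u.
  by rewrite lt_neqAle norm2_ge0 eq_sym andbT; apply/eqP => /norm2_eq0.
have pv : 0 < norm2 v.
  by rewrite lt_neqAle norm2_ge0 eq_sym andbT; apply/eqP => /norm2_eq0.
have := sqr_ge0 (norm2 (norm2 v *: u - norm2 u *: v)).
rewrite norm2_sqr dotvBl !dotvBr !dotvZl !dotvZr (dotvC v u) -!norm2_sqr => h.
rewrite -(ler_pM2l (mulr_gt0 pu pv)); nra.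
Qed.

Lemma norm2N u : norm2 (- u) = norm2 u.
Proof. by congr Num.sqrt; apply: eq_bigr => i _; rewrite mxE sqrrN. Qed.

Lemma norm2BC u v : norm2 (u - v) = norm2 (v - u).
Proof. by rewrite -norm2N opprB. Qed.

Lemma norm2Z a u : norm2 (a *: u) = `|a| * norm2 u.
Proof.
apply/eqP; rewrite -(@eqrXn2 _ 2)// ?mulr_ge0 ?norm2_ge0//.
by rewrite exprMn !norm2_sqr dotvZl dotvZr mulrA -expr2 real_normK ?num_real.
Qed.

Lemma ler_norm2D u v : norm2 (u + v) <= norm2 u + norm2 v.
Proof.
rewrite -(@ler_pXn2r _ 2)// ?nnegrE ?addr_ge0 ?norm2_ge0//.
rewrite norm2_sqr dotvDl !dotvDr (dotvC v u) sqrrD !norm2_sqr mulr2n.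
by have := dotv_le u v; lra.
Qed.

Lemma ler_norm2B u v : norm2 u <= norm2 v + norm2 (u - v).
Proof. by rewrite -{1}(subrK v u) addrC ler_norm2D. Qed.

Lemma norm2_sqrD u v :
  norm2 (u + v) ^+ 2 = norm2 u ^+ 2 + 2 * dotv u v + norm2 v ^+ 2.
Proof. by rewrite !norm2_sqr dotvDl !dotvDr (dotvC v u); ring. Qed.

Lemma abs_dotv_le u v : `|dotv u v| <= norm2 u * norm2 v.
Proof. by rewrite ler_norml lerNl -dotvNl -{1}(norm2N u) !dotv_le. Qed.

(** The factor [n] is cruder than its square root, but the bound only serves for grids whose mesh
    can be made arbitrarily small. *)
Lemma norm2_le_coord u (e : R) :
  (forall i, `|u 0 i| <= e) -> norm2 u <= n%:R * e.
Proof.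
move=> ue; have [n0|n_gt0] := posnP n.
  rewrite /norm2 big1 => [|i _]; first by rewrite sqrtr0 n0 mul0r.
  by have := ltn_ord i; rewrite [X in (_ < X)%N]n0.
have e0 : 0 <= e by apply: le_trans (ue (Ordinal n_gt0)).
rewrite -(@ler_pXn2r _ 2)// ?nnegrE ?mulr_ge0 ?norm2_ge0//.
rewrite norm2_sqr; apply: (@le_trans _ _ (\sum_(i < n) e ^+ 2)).
  apply: ler_sum => i _; rewrite -expr2 -real_normK ?num_real//.
  by rewrite ler_pXn2r// nnegrE.
rewrite sumr_const card_ord -[leLHS]mulr_natl exprMn ler_wpM2r ?sqr_ge0//.
by rewrite expr2 ler_peMl ?ler1n ?ler0n.
Qed.

End euclidean.

(** * Bounded integrals and total variation *)

Section bounded_integrals.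
Context d (T : measurableType d) (R : realType).
Variable m : {finite_measure set T -> \bar R}.
Implicit Types (D : set T) (f g : T -> R).

Lemma le_bounded_integrable D f (M : R) : measurable D -> measurable_fun setT f ->
  (forall x, D x -> `|f x| <= M) -> m.-integrable D (EFin \o f).
Proof.
move=> mD mf fM; apply: measurable_bounded_integrable => //.
- by rewrite ltey_eq fin_num_measure.
- exact: measurable_funS mf.
- exists M; split; first exact: num_real.
  by move=> r Mr x Dx; exact: le_trans (fM x Dx) (ltW Mr).
Qed.

Lemma Rintegral_sum D (I : Type) (r : seq I) (F : I -> T -> R) : measurable D ->
  (forall i, m.-integrable D (EFin \o F i)) ->
  m.-integrable D (EFin \o (fun x => \sum_(i <- r) F i x)) /\
  \int[m]_(x in D) (\sum_(i <- r) F i x) = \sum_(i <- r) \int[m]_(x in D) F i x.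
Proof.
move=> mD iF; elim: r => [|i r [ir IH]].
  split.
    rewrite (_ : _ \o _ = cst 0%E); first exact: integrable0.
    by apply/funext => x; rewrite /= big_nil.
  rewrite big_nil /Rintegral; under eq_integral do rewrite big_nil.
  by rewrite integral0.
have E : EFin \o (fun x => \sum_(j <- i :: r) F j x) =
    (fun x => (EFin \o F i) x + (EFin \o (fun x => (\sum_(j <- r) F j x)%R)) x)%E.
  by apply/funext => x; rewrite /= big_cons.
split; first by rewrite E; exact: integrableD.
rewrite big_cons/= -IH -RintegralD//.
by apply: eq_Rintegral => x _; rewrite big_cons.
Qed.

Lemma Rintegral_indic B : measurable B -> \int[m]_x \1_B x = fine (m B).
Proof. by move=> mB; rewrite /Rintegral integral_indic// setIT. Qed.

End bounded_integrals.

(** Counting the thresholds 1, ..., [N] that lie below [y] rounds [y] down; this rewrites a sum of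
    superlevel indicators as a rounded function. *)
Lemma sum_leqn_truncn (R : archiNumDomainType) (N : nat) (y : R) :
  0 <= y <= N%:R ->
  \sum_(i < N) ((i.+1%:R <= y)%R : nat)%:R = (Num.truncn y)%:R :> R.
Proof.
move=> /andP[y0 yN].
have tN : (Num.truncn y <= N)%N.
  by rewrite -(ler_nat R) (le_trans _ yN)// truncn_le.
transitivity (\sum_(i < N | (i < Num.truncn y)%N) 1 : R).
  by rewrite [RHS]big_mkcond/=; apply: eq_bigr => i _; rewrite truncn_gt_nat; case: ifP.
by rewrite -(big_ord_widen _ (fun=> 1 : R) tN) sumr_const card_ord.
Qed.

(* Approximation of [f + M] from below, within [2 M / N], by a positive
   combination of the indicators of [N] of its superlevel sets. *)
Lemma tv_Rintegral d (S : measurableType d) (R : realType)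
    (nu mu : {finite_measure set S -> \bar R}) (p e M : R) (f : S -> R) :
  0 <= p -> nu setT = p%:E -> mu setT = 1%E ->
  (forall B, measurable B -> fine (nu B) <= p * fine (mu B) + e) ->
  0 < M -> measurable_fun setT f -> (forall x, `|f x| <= M) ->
  \int[nu]_x f x <= p * \int[mu]_x f x + 2 * M * e.
Proof.
move=> p0 nup mu1 numu M0 mf fM.
apply/ler_addgt0Pr => eps eps0.
(* [N] is large enough that the rounding error [c], weighted by the mass [p], is at most [eps]. *)
pose N := (Num.truncn (2 * M * p / eps)).+1.
have N0 : 0 < N%:R :> R by rewrite ltr0n.
pose c := 2 * M / N%:R.
have c0 : 0 < c by rewrite divr_gt0// mulr_gt0.
have cN : c * N%:R = 2 * M by rewrite /c mulfVK// gt_eqF.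
have cp : c * p <= eps.
  rewrite /c mulrAC ler_pdivrMr// (mulrC eps) -ler_pdivrMr//.
  exact/ltW/truncnS_gt.
pose B (i : 'I_N) := f @^-1` `[(i.+1%:R * c - M), +oo[.
have mB i : measurable (B i) by rewrite -[B i]setTI; exact: mf.
pose s x := \sum_(i < N) c * \1_(B i) x.
have fM2 x : 0 <= f x + M <= 2 * M.
  by have := fM x; rewrite ler_norml => /andP[? ?]; apply/andP; split; lra.
(* [s] is [f + M] rounded down to a multiple of [c], hence within [c] of it. *)
have sE x : s x = c * (Num.truncn ((f x + M) / c))%:R.
  rewrite /s -mulr_sumr -(@sum_leqn_truncn _ N); last first.
    have /andP[fx0 fx1] := fM2 x.
    by rewrite divr_ge0 ?(ltW c0)//= ler_pdivrMr// mulrC cN.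
  congr (_ * _); apply: eq_bigr => i _.
  rewrite indicE; congr ((nat_of_bool _)%:R).
  apply/idP/idP; rewrite /B !inE/= in_itv/= andbT.
    by rewrite ler_pdivlMr// lerBlDr.
  by rewrite ler_pdivlMr// lerBlDr.
have y0 x : 0 <= (f x + M) / c.
  by have /andP[fx0 _] := fM2 x; rewrite divr_ge0 ?(ltW c0).
have s_le x : s x <= f x + M.
  by rewrite sE mulrC -ler_pdivlMr// truncn_le.
have s_ge x : f x + M <= s x + c.
  have := ltW (truncnS_gt ((f x + M) / c)).
  by rewrite -natr1 ler_pdivrMr// mulrDl mul1r sE (mulrC c).
have ms i : measurable_fun setT (fun x => c * \1_(B i) x).
  by apply: measurable_funM => //; exact: measurable_indic.
have is_ (m : {finite_measure set S -> \bar R}) i :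
    m.-integrable setT (EFin \o (fun x => c * \1_(B i) x)).
  apply: (@le_bounded_integrable _ _ _ _ _ _ (c)) => // x _.
  by rewrite normrM gtr0_norm// ler_piMr ?(ltW c0)// indicE; case: (_ \in _);
    rewrite ?normr1 ?normr0.
have iB (m : {finite_measure set S -> \bar R}) : 
    \int[m]_x s x = c * \sum_(i < N) fine (m (B i)).
  have [_ ->] := Rintegral_sum (index_enum 'I_N) measurableT (is_ m).
  rewrite mulr_sumr; apply: eq_bigr => i _.
  rewrite RintegralZl//; first by rewrite Rintegral_indic.
  apply: (@le_bounded_integrable _ _ _ _ _ _ (1)) => // x _.
  by rewrite indicE; case: (_ \in _); rewrite ?normr1 ?normr0.
have is' (m : {finite_measure set S -> \bar R}) :
    m.-integrable setT (EFin \o s).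
  by have [] := Rintegral_sum (index_enum 'I_N) measurableT (is_ m).
have ic (m : {finite_measure set S -> \bar R}) (r : R) :
    m.-integrable setT (EFin \o cst r).
  by apply: (@le_bounded_integrable _ _ _ _ _ _ (`|r|)).
have i_f (m : {finite_measure set S -> \bar R}) : m.-integrable setT (EFin \o f).
  by apply: (@le_bounded_integrable _ _ _ _ _ _ (M)).
have icE (m : {finite_measure set S -> \bar R}) (g : S -> R) (r : R) :
    m.-integrable setT (EFin \o g) ->
    \int[m]_x (g x + r) = \int[m]_x g x + r * fine (m setT).
  by move=> ig; rewrite RintegralD//; [rewrite Rintegral_cst | exact: ic].
have ifc (m : {finite_measure set S -> \bar R}) (g : S -> R) (r : R) :
    m.-integrable setT (EFin \o g) ->
    m.-integrable setT (EFin \o (fun x => g x + r)).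
  move=> ig; rewrite (_ : _ \o _ = (EFin \o g) \+ (EFin \o cst r))%E//.
  by apply: integrableD => //; exact: ic.
have h1 : \int[nu]_x (f x + M) <= \int[nu]_x (s x + c).
  by apply: le_Rintegral => //; apply: ifc; [exact: i_f | exact: is'].
have h2 : \int[mu]_x (s x) <= \int[mu]_x (f x + M).
  by apply: le_Rintegral => //; [exact: is' | exact/ifc/i_f].
(* Each superlevel set costs [e]; after multiplication by [c] the [N] costs add up to [2 * M * e],
   whatever [N] is. *)
have h3 : \sum_(i < N) fine (nu (B i)) <=
    p * (\sum_(i < N) fine (mu (B i))) + e * N%:R.
  rewrite mulr_sumr mulr_natr -[N in e *+ N]card_ord -sumr_const -big_split/=.
  by apply: ler_sum => i _; exact: numu.
move: h1 h2; rewrite !icE// nup mu1 /= !iB.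
have := ler_wpM2l (ltW c0) h3; move: cp.
rewrite !mulrDr (mulrCA c p) (mulrCA c e) cN; set X := c * \sum_(i < _) _.
set Y := c * \sum_(i < _) _.
move=> h4 h5 h6 /(ler_wpM2l p0).
by rewrite mulr1; lra.
Qed.

(** * Integration against a mixture of measures *)

Section integral_mixture.
Context d1 d2 (T1 : measurableType d1) (T2 : measurableType d2) (R : realType).
Variables (m : {measure set T1 -> \bar R}) (D : set T1).
Variables (k : T1 -> {measure set T2 -> \bar R}) (nu : {measure set T2 -> \bar R}).
Hypothesis mD : measurable D.
Hypothesis mk : forall U, measurable U -> measurable_fun setT (k ^~ U).
Hypothesis nuE : forall U, measurable U -> nu U = (\int[m]_(x in D) k x U)%E.

Local Open Scope ereal_scope.
Import HBNNSimple.

Let mkD U : measurable U -> measurable_fun D (k ^~ U).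
Proof. by move=> mU; apply: measurable_funTS; exact: mk. Qed.

Let integral_mixture_nnsfun (f : {nnsfun T2 >-> R}) :
  \int[nu]_y (f y)%:E = \int[m]_(x in D) \int[k x]_y (f y)%:E.
Proof.
have fE (l : {measure set T2 -> \bar R}) :
    \int[l]_y (f y)%:E = \sum_(r \in range f) r%:E * l (f @^-1` [set r]).
  by rewrite integralT_nnsfun sintegralE.
under [RHS]eq_integral do rewrite fE.
rewrite fE ge0_integral_fsum//; last 2 first.
  - by move=> r; apply: measurable_funeM; exact: mkD.
  - move=> r x _; have := @mulemu_ge0 _ _ _ (k x) r (fun n => f @^-1` [set n]).
    by apply => r0; exact: preimage_nnfun0.
apply: eq_fsbigr => r _; rewrite nuE//.
(* A negative [r] is not a value of [f]: its level set is empty and both sides vanish. *)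
have [r0|r0] := leP 0%R r; first by rewrite ge0_integralZl//; exact: mkD.
rewrite integral0_eq ?mule0; last first.
  by move=> x _; rewrite preimage_nnfun0// measure0.
by rewrite integral0_eq// => x _; rewrite preimage_nnfun0// measure0 mule0.
Qed.

(** From simple functions to nonnegative ones by monotone convergence, used for the inner integrals
    and then for the outer one. *)
Lemma integral_mixture (f : T2 -> \bar R) : (forall y, 0 <= f y) ->
  measurable_fun setT f ->
  \int[nu]_y f y = \int[m]_(x in D) \int[k x]_y f y.
Proof.
move=> f0 mf; pose f_ := nnsfun_approx measurableT mf.
have fE (l : {measure set T2 -> \bar R}) :
    \int[l]_y f y = lim (\int[l]_y (f_ n y)%:E @[n --> \oo]).
  rewrite -monotone_convergence//.
  - by apply: eq_integral => y _; apply/esym/cvg_lim => //; exact: cvg_nnsfun_approx.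
  - by move=> n; exact/measurable_EFinP.
  - by move=> n y _; rewrite lee_fin.
  - by move=> y _ a b ab; rewrite lee_fin; exact/lefP/nd_nnsfun_approx.
under [RHS]eq_integral do rewrite fE.
rewrite fE monotone_convergence//.
- by congr (limn _); apply/funext => n; exact: integral_mixture_nnsfun.
- move=> n; apply: measurable_funTS; apply: measurable_fun_integral_kernel => //.
  + by move=> z; rewrite lee_fin.
  + exact/measurable_EFinP.
- by move=> n x _; apply: integral_ge0 => // y _; rewrite lee_fin.
- move=> x _ a b ab; apply: ge0_le_integral => //.
  + by move=> y _; rewrite lee_fin.
  + exact/measurable_EFinP.
  + exact/measurable_EFinP.
  + by move=> y _; rewrite lee_fin; exact/lefP/nd_nnsfun_approx.
Qed.

End integral_mixture.

(** * Substitution into Lipschitz families *)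

(** The fibres of [q] form a countable measurable partition, along which the functions [f z] are
    glued. *)
Lemma measurable_fun_countable_choice d d' (T : measurableType d)
    (U : measurableType d') (I : countType) (q : T -> I) (f : I -> T -> U) :
  (forall z, measurable (q @^-1` [set z])) ->
  (forall z, measurable_fun setT (f z)) ->
  measurable_fun setT (fun t => f (q t) t).
Proof.
move=> mq mf _ B mB; rewrite setTI.
rewrite (_ : _ @^-1` B = \bigcup_n
  (* The union runs over codes of elements of [I]; a number that codes nothing contributes the empty
     set. *)
  (if unpickle n is Some z then q @^-1` [set z] `&` f z @^-1` B else set0)).
  apply: bigcupT_measurable => n; case: unpickle => // z.
  by apply: measurableI => //; rewrite -[X in measurable X]setTI; exact: mf.
apply/seteqP; split => [t Bt|t [n _]].
  by exists (pickle (q t)) => //; rewrite pickleK.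
by case: unpickle => // z [/= <-].
Qed.

Section grid.
Context (R : realType) (d : nat).
Implicit Types v : 'rV[R]_d.

(** Labels the half-open cube of side [1 / N.+1] that contains [v]. The labels form a countable
    type, so the cells can be enumerated. *)
Definition grid_index (N : nat) v : 'rV[int]_d :=
  \row_i Num.floor (N.+1%:R * v 0 i).

Definition grid_point (N : nat) (z : 'rV[int]_d) : 'rV[R]_d :=
  \row_i ((z 0 i)%:~R / N.+1%:R).

Lemma grid_approx N v :
  norm2 (v - grid_point N (grid_index N v)) <= d%:R / N.+1%:R.
Proof.
apply: norm2_le_coord => i; rewrite !mxE.
have N0 : 0 < N.+1%:R :> R by rewrite ltr0n.
have /andP[h1 h2] := floor_itv (N.+1%:R * v 0 i).
rewrite ger0_norm ?subr_ge0; last by rewrite ler_pdivrMr// (mulrC (v 0 i)).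
rewrite lerBlDr -[X in _ <= X + _]mul1r -mulrDl ler_pdivlMr// (mulrC (v 0 i)).
by rewrite (le_trans (ltW h2))// intrD addrC.
Qed.

Lemma measurable_coord i : measurable_fun setT (fun v => v 0 i).
Proof.
move=> _ B mB; apply: sub_sigma_algebra; exists i => //; exists B => //.
Qed.

Lemma measurable_rVP d' (T : measurableType d') (Y : T -> 'rV[R]_d) :
  measurable_fun setT Y <-> forall i, measurable_fun setT (fun t => Y t 0 i).
Proof.
split=> [mY i|mY]; first exact: (measurableT_comp (measurable_coord i)).
apply: (@measurability _ _ _ _ _ _ (rV_cylinders R d)) => //.
move=> _ [_ [i _ [B mB <-]] <-]; rewrite !setTI.
by have := mY i measurableT B mB; rewrite setTI.
Qed.

Lemma measurable_grid_cell N z : measurable (grid_index N @^-1` [set z]).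
Proof.
rewrite (_ : _ @^-1` _ = \bigcap_(i in [set: 'I_d])
  ((fun v => v 0 i) @^-1`
    `[(z 0 i)%:~R / N.+1%:R, (z 0 i + 1)%:~R / N.+1%:R[)).
  apply: fin_bigcap_measurable => // i _.
  by rewrite -[X in measurable X]setTI; exact: measurable_coord.
have N0 : 0 < N.+1%:R :> R by rewrite ltr0n.
have E v i : (grid_index N v 0 i == z 0 i) = (v 0 i \in
    `[(z 0 i)%:~R / N.+1%:R, (z 0 i + 1)%:~R / N.+1%:R[).
  by rewrite mxE floor_eq in_itv/= ler_pdivrMr// ltr_pdivlMr// (mulrC (v 0 i)).
apply/seteqP; split => [v /= vz i _|v vz] /=.
  by have := E v i; rewrite vz eqxx => /esym.
by apply/rowP => i; apply/eqP; rewrite E; exact: vz.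
Qed.

End grid.

Section lipschitz_substitution.
Context (R : realType) (n : nat) d (T : measurableType d).
Variables (Y : T -> 'rV[R]_n) (Z : 'rV[R]_n -> T -> R).
Hypothesis mY : measurable_fun setT Y.
Hypothesis mZ : forall v, measurable_fun setT (Z v).

Let Yg N t := grid_point R N (grid_index N (Y t)).

Let mYcell N z : measurable ((grid_index N \o Y) @^-1` [set z]).
Proof.
rewrite comp_preimage -[X in measurable X]setTI; apply: mY => //.
exact: measurable_grid_cell.
Qed.

Let mZg N : measurable_fun setT (fun t => Z (Yg N t) t).
Proof.
exact: (@measurable_fun_countable_choice _ _ _ _ _ (grid_index N \o Y)
  (fun z => Z (grid_point R N z))).
Qed.

Let invS_small (a e : R) : 0 < e -> exists N : nat,
  forall M : nat, (N <= M)%N -> a / M.+1%:R <= e.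
Proof.
move=> e0; exists (Num.truncn (a / e)) => M NM.
rewrite ler_pdivrMr ?ltr0n// mulrC -ler_pdivrMr//.
by rewrite (le_trans (ltW (truncnS_gt _)))// ler_nat.
Qed.

(** Rounding [Y] to the grid gives functions that are measurable by gluing over cells, and the
    Lipschitz bound makes them converge pointwise as the mesh tends to 0. *)
Lemma measurable_lipschitz_subst (K : R) :
  (forall v v' t, `|Z v t - Z v' t| <= K * norm2 (v - v')) ->
  measurable_fun setT (fun t => Z (Y t) t).
Proof.
move=> ZK; apply: (measurable_fun_cvg mZg) => t _.
apply/cvgrPdist_le => e e0.
have [N HN] := invS_small (`|K| * n%:R) e0.
exists N => // M /= NM; apply: le_trans (ZK _ _ _) _.
apply: le_trans (HN M NM); apply: (@le_trans _ _ (`|K| * norm2 (Y t - Yg M t))).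
  by rewrite ler_wpM2r ?norm2_ge0// ler_norm.
by rewrite -mulrA ler_wpM2l// grid_approx.
Qed.

(* On a cell of a fine grid [Y] is nearly a constant [v], and the cell is an
   event of the sigma-algebra generated by [Y]. *)
Lemma Rintegral_subst_le0 (m : {finite_measure set T -> \bar R}) (D : set T)
    (B K M : R) :
  measurable D ->
  measurable_fun setT (fun t => Z (Y t) t) ->
  (forall t, D t -> norm2 (Y t) <= B) ->
  (forall v v' t, D t -> norm2 v <= B + n%:R -> norm2 v' <= B + n%:R ->
    `|Z v t - Z v' t| <= K * norm2 (v - v')) ->
  (forall v t, D t -> norm2 v <= B + n%:R -> `|Z v t| <= M) ->
  (forall v C, measurable C ->
    (\int[m]_(t in D `&` Y @^-1` C) (Z v t)%:E <= 0)%E) ->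
  m.-integrable D (EFin \o (fun t => Z (Y t) t)) /\
  \int[m]_(t in D) Z (Y t) t <= 0.
Proof.
move=> mD mZY YB ZK ZM Zle0.
(* A grid point is within [n] of the point it replaces for every mesh, whence the radius [B + n%:R]
   in the hypotheses. *)
have YgB N t : D t -> norm2 (Yg N t) <= B + n%:R.
  move=> Dt; rewrite (le_trans (ler_norm2B _ (Y t)))// lerD ?YB//.
  rewrite norm2BC (le_trans (grid_approx _ _))//.
  by rewrite ler_pdivrMr ?ltr0n// ler_peMr ?ler0n ?ler1n.
have YB' t : D t -> norm2 (Y t) <= B + n%:R.
  by move=> Dt; rewrite (le_trans (YB t Dt))// lerDl.
have iZY : m.-integrable D (EFin \o (fun t => Z (Y t) t)).
  apply: (@le_bounded_integrable _ _ _ _ _ _ M) => // t Dt.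
  by apply: ZM => //; exact: YB'.
have iZg N : m.-integrable D (EFin \o (fun t => Z (Yg N t) t)).
  apply: (@le_bounded_integrable _ _ _ _ _ _ M) => // t Dt.
  by apply: ZM => //; exact: YgB.
have Zg_le0 N : \int[m]_(t in D) Z (Yg N t) t <= 0.
  rewrite /Rintegral fine_le0//.
  (* The cells are numbered by the codes of their labels, since countable additivity of the integral
     is stated for sequences of sets. *)
  pose F j := D `&` [set t | pickle (grid_index N (Y t)) = j].
  have FE z : F (pickle z) = D `&` Y @^-1` (grid_index N @^-1` [set z]).
    apply/seteqP; split=> t [Dt /= zt]; split => //=; last by rewrite zt.
    exact: (pcan_inj (@pickleK _)).
  have DF : D = \bigcup_j F j.
    apply/seteqP; split => [t Dt|t [j _ []]//].
    by exists (pickle (grid_index N (Y t))).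
  have F0 j : (forall z : 'rV[int]_n, pickle z <> j) -> F j = set0.
    by move=> zj; rewrite -subset0 => t [_ /= /zj].
  have mF j : measurable (F j).
    have [[z <-]|/forallNP/F0 ->//] := pselect (exists z : 'rV[int]_n, pickle z = j).
    by rewrite FE; apply: measurableI => //; exact: mYcell.
  have tF : trivIset setT F.
    apply/trivIsetP => i j _ _ /eqP ij; rewrite -subset0 => t [[_ /= ti] [_ /= tj]].
    by apply: ij; rewrite -ti -tj.
  rewrite [X in (\int[_]_(_ in X) _)%E]DF integral_bigcup//; last first.
    by rewrite -DF; exact: iZg.
  apply: npeseries_le0 => j _ _.
  have [[z <-]|/forallNP/F0 ->] :=
    pselect (exists z : 'rV[int]_n, pickle z = j); last first.
    by rewrite integral_set0.
  rewrite FE (eq_integral (fun t => (Z (grid_point R N z) t)%:E)); last first.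
    by move=> t; rewrite inE => -[_ /= zt]; rewrite /Yg zt.
  by apply: Zle0; exact: measurable_grid_cell.
split=> //; apply/ler_addgt0Pr => e e0; rewrite add0r.
(* The mesh is chosen so that rounding [Y] costs at most [e] in the integral over [D]. *)
have [N HN] := invS_small (`|K| * n%:R * fine (m D)) e0.
apply: le_trans (HN N (leqnn N)).
pose c := `|K| * n%:R / N.+1%:R.
apply: (@le_trans _ _ (\int[m]_(t in D) (Z (Yg N t) t + c))).
  apply: le_Rintegral => //.
    apply: (@integrableD _ _ _ m D mD (EFin \o (fun t => Z (Yg N t) t))
      (EFin \o cst c)) => //.
    by apply: (@le_bounded_integrable _ _ _ _ _ _ `|c|).
  move=> t Dt; rewrite -lerBlDl (le_trans (ler_norm _))//.
  rewrite (le_trans (ZK _ _ _ Dt (YB' t Dt) (YgB N t Dt)))//.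
  apply: (@le_trans _ _ (`|K| * norm2 (Y t - Yg N t))).
    by rewrite ler_wpM2r ?norm2_ge0// ler_norm.
  by rewrite /c -mulrA ler_wpM2l// grid_approx.
rewrite RintegralD//; last by apply: (@le_bounded_integrable _ _ _ _ _ _ `|c|).
rewrite Rintegral_cst// /c mulrAC -[leRHS]add0r lerD//.
Qed.

End lipschitz_substitution.

(** * Mixing of the Markov chain *)

Section event_law.
Context d d' (T : measurableType d) (S : measurableType d') (R : realType).
Variables (m : {finite_measure set T -> \bar R}) (X : {mfun T >-> S}).
Variables (A : set T) (mA : measurable A).

(** Law of [X] on the event [A], left unnormalised so that null events need no special treatment.
    The proof that [A] is measurable is an argument so that the measure structure can be
    attached. *)
Definition event_law & measurable A := fun B : set S => m (A `&` X @^-1` B).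

Local Notation law := (event_law mA).

Let mX B : measurable B -> measurable (X @^-1` B).
Proof. by move=> mB; rewrite -[X in measurable X]setTI; exact: measurable_funPT. Qed.

Let law0 : law set0 = 0%E.
Proof. by rewrite /event_law preimage_set0 setI0 measure0. Qed.

Let law_ge0 B : (0 <= law B)%E.
Proof. exact: measure_ge0. Qed.

Let law_sigma_additive : semi_sigma_additive law.
Proof.
move=> F mF tF mUF; rewrite /event_law preimage_bigcup setI_bigcupr.
apply: measure_semi_sigma_additive.
- by move=> n; apply: measurableI => //; exact: mX.
- apply/trivIsetP => /= i j _ _ ij; rewrite setIACA -preimage_setI.
  by move/trivIsetP : tF => /(_ _ _ _ _ ij) ->//; rewrite preimage_set0 setI0.
- by rewrite -setI_bigcupr -preimage_bigcup; apply: measurableI => //; exact: mX.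
Qed.

HB.instance Definition _ :=
  isMeasure.Build _ _ _ law law0 law_ge0 law_sigma_additive.

Let law_fin : fin_num_fun law.
Proof.
by move=> B mB; apply: fin_num_measure; apply: measurableI => //; exact: mX.
Qed.

HB.instance Definition _ := Measure_isFinite.Build _ _ _ law law_fin.

(** The law is the mixture over [A] of the Dirac masses at [X t]; signed functions follow by
    splitting into positive and negative parts. *)
Lemma integral_event_law (f : S -> \bar R) : measurable_fun setT f ->
  (\int[law]_y f y = \int[m]_(t in A) f (X t))%E.
Proof.
have ge0 (g : S -> \bar R) : (forall y, 0 <= g y)%E -> measurable_fun setT g ->
    (\int[law]_y g y = \int[m]_(t in A) g (X t))%E.
  move=> g0 mg.
  rewrite (@integral_mixture _ _ _ _ _ m A (fun t => dirac (X t)))//.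
  - by apply: eq_integral => t _; rewrite integral_dirac// diracT mul1e.
  - move=> U mU; apply/measurable_EFinP.
    apply: (@measurableT_comp _ _ _ _ _ _ (\1_U : S -> R)).
      exact: measurable_indic.
    exact: measurable_funPT.
  - move=> U mU; rewrite /= /event_law setIC -integral_indic//; exact: mX.
move=> mf; rewrite integralE [RHS]integralE !ge0//.
- by congr (_ - _)%E; apply: eq_integral => t _; rewrite ?funeposE ?funenegE.
- exact: measurable_funeneg.
- exact: measurable_funepos.
Qed.

End event_law.

Section mixing.
Context dS (S : measurableType dS) (R : realType) (P : R.-pker S ~> S).
Context dO (Omega : measurableType dO) (Pr : probability Omega R).
Variables (G : nat -> set (set Omega)) (X : nat -> {mfun Omega >-> S}).
Hypothesis G_mono : forall i j, (i <= j)%N -> G i `<=` G j.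
Hypothesis G_meas : forall i A, G i A -> measurable A.
Hypothesis X_markov : markov_chain P Pr G X.

(** Chapman-Kolmogorov by induction on [s]: [A] is also an event of [G (i + s)], so the Markov
    property applies at the last step, and the law of [X (i + s)] on [A] is by induction a mixture
    of the kernels [kpow P s]. *)
Lemma markov_kpow s i (A : set Omega) (B : set S) : G i A -> measurable B ->
  Pr (A `&` X (i + s)%N @^-1` B) = (\int[Pr]_(t in A) kpow P s (X i t) B)%E.
Proof.
move=> GA; have mA := G_meas GA.
have mX j (C : set S) : measurable C -> measurable (X j @^-1` C).
  by move=> mC; rewrite -[X in measurable X]setTI; exact: measurable_funPT.
elim: s B => [|s IH] B mB.
  by rewrite addn0 setIC -integral_indic//; exact: mX.
have [_ _ _ /(_ A)] := X_markov (i + s) mB.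
move=> /(_ (G_mono (leq_addr s i) GA)).
rewrite integral_indic//; last exact: mX.
rewrite addnS setIC => <-.
transitivity (\int[Pr]_(t in A) P (X (i + s)%N t) B)%E.
  by apply: eq_integral => t _; rewrite fineK//; exact: finite_kernel_measure.
have mPB : measurable_fun setT (P ^~ B) by exact: measurable_kernel.
transitivity (\int[event_law Pr (X (i + s)%N) mA]_y P y B)%E.
  by rewrite integral_event_law.
rewrite (@integral_mixture _ _ _ _ _ Pr A (fun t => kpow P s (X i t)))//.
move=> U mU.
by apply: (@measurableT_comp _ _ _ _ _ _ (kpow P s ^~ U)) => //; exact: measurable_kernel.
Qed.

Variable mu : probability S R.

Lemma sup_tv_mixing s i (A : set Omega) (B : set S) (e : R) :
  (sup_tv P mu s <= e%:E)%E -> G i A -> measurable B ->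
  fine (Pr (A `&` X (i + s)%N @^-1` B)) <=
  fine (Pr A) * fine (mu B) + e * fine (Pr A).
Proof.
move=> tve GA mB; have mA := G_meas GA.
have kB x : (kpow P s x B <= mu B + e%:E)%E.
  rewrite -leeBlDl ?fin_num_measure//.
  apply: le_trans (lee_abs _) _; apply: le_trans tve.
  apply: (@le_trans _ _ (tv_dist (kpow P s x) mu)).
    by apply: ereal_sup_ubound; exists B.
  by apply: ereal_sup_ubound; exists x.
rewrite markov_kpow//.
have -> : fine (Pr A) * fine (mu B) + e * fine (Pr A) =
    fine (\int[Pr]_(t in A) (fine (mu B) + e)%:E)%E.
  rewrite integral_cst// fineM//; last by rewrite fin_num_measure.
  by rewrite /= mulrDl mulrC.
have muE : (mu B + e%:E)%E = (fine (mu B) + e)%:E.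
  by rewrite EFinD fineK// fin_num_measure.
have mk : measurable_fun A (fun t => kpow P s (X i t) B).
  apply: measurable_funTS.
  apply: (@measurableT_comp _ _ _ _ _ _ (kpow P s ^~ B)) => //.
  exact: measurable_kernel.
apply: fine_le.
- rewrite -markov_kpow// fin_num_measure//; apply: measurableI => //.
  by rewrite -[X in measurable X]setTI; exact: measurable_funPT.
- by rewrite integral_cst// fin_numM// fin_num_measure.
apply: ge0_le_integral => //.
- by move=> t _; rewrite -muE (le_trans _ (kB (X i t))).
Qed.

(** The total variation estimate for the law of [X (i + s)] on [A], of mass [Pr A], with error
    [e * Pr A]. *)
Lemma mixing_Rintegral s i (A : set Omega) (e M : R) (f : S -> R) :
  (sup_tv P mu s <= e%:E)%E -> G i A -> 0 < M ->
  measurable_fun setT f -> (forall x, `|f x| <= M) ->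
  \int[Pr]_(t in A) f (X (i + s)%N t) <=
  fine (Pr A) * (\int[mu]_x f x + 2 * M * e).
Proof.
move=> tve GA M0 mf fM; have mA := G_meas GA.
rewrite /Rintegral -(@integral_event_law _ _ _ _ _ Pr _ A mA (EFin \o f)); last first.
  exact/measurable_EFinP.
rewrite mulrDr.
have -> : fine (Pr A) * (2 * M * e) = 2 * M * (e * fine (Pr A)) by ring.
apply: tv_Rintegral => //.
- by rewrite fine_ge0.
- by rewrite /= /event_law preimage_setT setIT fineK// fin_num_measure.
- exact: probability_setT.
- by move=> B mB; exact: sup_tv_mixing.
Qed.

End mixing.

(** * Lipschitz fields and their means *)

Section norm2_dual.
Context (R : realType) (n : nat).

(** Duality, tested at [u = a]. It reduces norm bounds on the mean field to scalar integrals. *)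
Lemma norm2_le_dotv (a : 'rV[R]_n) (c : R) : 0 <= c ->
  (forall u, dotv u a <= norm2 u * c) -> norm2 a <= c.
Proof.
move=> c0 h; have := h a; rewrite -norm2_sqr expr2.
have [->//|a0] := eqVneq (norm2 a) 0.
by rewrite ler_pM2l// lt_neqAle eq_sym a0 norm2_ge0.
Qed.

Lemma ler_dist_norm2 (u v : 'rV[R]_n) : `|norm2 u - norm2 v| <= norm2 (u - v).
Proof.
have := ler_norm2B u v; have := ler_norm2B v u; rewrite (norm2BC v u).
by rewrite ler_norml; lra.
Qed.

Context d (T : measurableType d).
Implicit Types Y Z : T -> 'rV[R]_n.

Lemma measurable_dotv Y Z : measurable_fun setT Y -> measurable_fun setT Z ->
  measurable_fun setT (fun t => dotv (Y t) (Z t)).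
Proof.
move=> /measurable_rVP mY /measurable_rVP mZ.
by apply: measurable_sum => i; apply: measurable_funM.
Qed.

Lemma measurable_norm2 Y : measurable_fun setT Y ->
  measurable_fun setT (fun t => norm2 (Y t)).
Proof.
move=> mY; apply: (@measurable_lipschitz_subst _ _ _ _ Y (fun v _ => norm2 v) mY _ 1).
  by move=> v; exact: measurable_cst.
by move=> v v' _; rewrite mul1r ler_dist_norm2.
Qed.

Lemma measurable_rVD Y Z : measurable_fun setT Y -> measurable_fun setT Z ->
  measurable_fun setT (fun t => Y t + Z t).
Proof.
move=> /measurable_rVP mY /measurable_rVP mZ; apply/measurable_rVP => i.
under eq_fun do rewrite mxE.
exact: measurable_funD.
Qed.

Lemma measurable_rVZ a Y : measurable_fun setT Y ->
  measurable_fun setT (fun t => a *: Y t).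
Proof.
move=> /measurable_rVP mY; apply/measurable_rVP => i.
under eq_fun do rewrite mxE.
by apply: measurable_funM.
Qed.

Lemma measurable_rVB Y Z : measurable_fun setT Y -> measurable_fun setT Z ->
  measurable_fun setT (fun t => Y t - Z t).
Proof.
move=> mY mZ; under eq_fun do rewrite -scaleN1r.
by apply: measurable_rVD => //; exact: measurable_rVZ.
Qed.

End norm2_dual.

Section lipschitz_field.
Context (R : realType) (n : nat) d (S : measurableType d).
Variables (mu : probability S R) (F : S -> 'rV[R]_n -> 'rV[R]_n) (L : R).
Hypothesis mF : forall v, measurable_fun setT (F ^~ v).
Hypothesis L0 : 0 < L.
Hypothesis F_lip : forall x u v, norm2 (F x u - F x v) <= L * norm2 (u - v).
Hypothesis F_bnd : forall x, norm2 (F x 0) <= L.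

Let Fbar := mean_field mu F.

Lemma field_growth x v : norm2 (F x v) <= L * (norm2 v + 1).
Proof.
have := ler_norm2B (F x v) (F x 0); have := F_lip x v 0; have := F_bnd x.
by rewrite subr0; lra.
Qed.

Lemma abs_dotv_field u x v : `|dotv u (F x v)| <= norm2 u * (L * (norm2 v + 1)).
Proof.
by rewrite (le_trans (abs_dotv_le _ _))// ler_wpM2l ?norm2_ge0// field_growth.
Qed.

Lemma measurable_dotv_field u v : measurable_fun setT (fun x => dotv u (F x v)).
Proof. by apply: measurable_dotv => //; exact: measurable_cst. Qed.

Let integrable_field u v : mu.-integrable setT (EFin \o (fun x => dotv u (F x v))).
Proof.
apply: (@le_bounded_integrable _ _ _ _ _ _ (norm2 u * (L * (norm2 v + 1)))) => //.
  exact: measurable_dotv_field.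
by move=> x _; exact: abs_dotv_field.
Qed.

Lemma dotv_mean_field u v : dotv u (Fbar v) = \int[mu]_x dotv u (F x v).
Proof.
have iF i : mu.-integrable setT (EFin \o (fun x => F x v 0 i)).
  apply: (@le_bounded_integrable _ _ _ _ _ _ (L * (norm2 v + 1))) => //.
    exact: (measurable_rVP _).1.
  by move=> x _; rewrite (le_trans (norm2_coord _ _))// field_growth.
have iuF i : mu.-integrable setT (EFin \o (fun x => u 0 i * F x v 0 i)).
  rewrite (_ : _ \o _ = (fun x => (u 0%R i)%:E * (EFin \o (fun x => (F x v 0 i)%R)) x)%E).
    exact: integrableZl.
  by apply/funext => x; rewrite /= EFinM.
have [_ ->] := Rintegral_sum (index_enum 'I_n) measurableT iuF.
apply: eq_bigr => i _; rewrite RintegralZl//; congr (_ * _).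
by rewrite mxE /Rintegral unlock.
Qed.

Lemma mean_field_lip u v : norm2 (Fbar u - Fbar v) <= L * norm2 (u - v).
Proof.
apply: norm2_le_dotv; first by rewrite mulr_ge0 ?norm2_ge0 ?ltW.
move=> z; rewrite dotvBr !dotv_mean_field.
rewrite -RintegralB//; [|exact: integrable_field..].
apply: (@le_trans _ _ (\int[mu]_x (norm2 z * (L * norm2 (u - v))))).
  apply: le_Rintegral => //.
  - rewrite (_ : _ \o _ = (EFin \o (fun x => dotv z (F x u))) \-
      (EFin \o (fun x => dotv z (F x v))))%E//.
    exact: integrableB.
  - exact: (@le_bounded_integrable _ _ _ _ _ _
      `|norm2 z * (L * norm2 (u - v))|).
  - move=> x _; rewrite -dotvBr (le_trans (dotv_le _ _))//.
    by rewrite ler_wpM2l ?norm2_ge0.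
by rewrite Rintegral_cst// [X in fine X](probability_setT mu) mulr1.
Qed.

Lemma mean_field_growth v : norm2 (Fbar v) <= L * (norm2 v + 1).
Proof.
apply: norm2_le_dotv; first by rewrite mulr_ge0 ?addr_ge0 ?norm2_ge0 ?ltW.
move=> z; rewrite dotv_mean_field.
apply: (@le_trans _ _ (\int[mu]_x (norm2 z * (L * (norm2 v + 1))))).
  apply: le_Rintegral => //.
  - exact: (@le_bounded_integrable _ _ _ _ _ _
      `|norm2 z * (L * (norm2 v + 1))|).
  - by move=> x _; rewrite (le_trans (ler_norm _))// abs_dotv_field.
by rewrite Rintegral_cst// [X in fine X](probability_setT mu) mulr1.
Qed.

(** Compare dissipation and Lipschitz bound at [vs + e], where [e] is the all-ones vector, nonzero
    as [n > 0]. The inequality later turns smallness of [L ^+ 2 * M] relative to [c0] into smallness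
    of [L * M]. *)
Lemma dissipation_le_lipschitz (c0 : R) (vs : 'rV[R]_n) : (0 < n)%N ->
  Fbar vs = 0 ->
  (forall v, dotv (v - vs) (Fbar v) <= - c0 * norm2 (v - vs) ^+ 2) -> c0 <= L.
Proof.
move=> n_gt0 Fvs diss.
pose e : 'rV[R]_n := const_mx 1.
have e0 : 0 < norm2 e.
  rewrite lt_neqAle norm2_ge0 eq_sym andbT; apply/eqP => /norm2_eq0.
  by move=> /rowP/(_ (Ordinal n_gt0)); rewrite !mxE => /eqP; rewrite oner_eq0.
have := diss (vs + e); rewrite addrC addrA addNr add0r => de.
have := dotv_le (- e) (Fbar (e + vs) - Fbar vs).
have := mean_field_lip (e + vs) vs.
rewrite Fvs subr0 addrK dotvNl norm2N => h1 h2.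
have := ler_wpM2l (ltW e0) h1 => h3.
have : c0 * norm2 e ^+ 2 <= L * norm2 e ^+ 2.
  rewrite [vs + e]addrC in de; move: de h2 h3; rewrite expr2; nra.
by rewrite ler_pM2r// exprn_gt0.
Qed.

Context dT (T : measurableType dT) (X : T -> S) (Y : T -> 'rV[R]_n).
Hypotheses (mX : measurable_fun setT X) (mY : measurable_fun setT Y).

(** Measurability in the state at each frozen parameter and Lipschitz continuity in the parameter
    combine through the grid. *)
Lemma measurable_field_comp : measurable_fun setT (fun t => F (X t) (Y t)).
Proof.
apply/measurable_rVP => i.
apply: (@measurable_lipschitz_subst _ _ _ _ Y (fun v t => F (X t) v 0 i) mY _ L).
  move=> v; apply: (@measurableT_comp _ _ _ _ _ _ (fun x => F x v 0 i)) => //.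
  exact: (measurable_rVP _).1.
move=> u v t; apply: le_trans (F_lip (X t) u v).
by rewrite (le_trans _ (norm2_coord _ i))// !mxE.
Qed.

Lemma measurable_mean_field_comp : measurable_fun setT (fun t => Fbar (Y t)).
Proof.
apply/measurable_rVP => i.
apply: (@measurable_lipschitz_subst _ _ _ _ Y (fun v t => Fbar v 0 i) mY _ L).
  by move=> v; exact: measurable_cst.
move=> u v t; apply: le_trans (mean_field_lip u v).
by rewrite (le_trans _ (norm2_coord _ i))// !mxE.
Qed.

End lipschitz_field.

(** * Events of the past *)

Section history.
Context dO (Omega : measurableType dO) dS (S : measurableType dS) (R : realType)
  (n : nat).
Variables (theta : nat -> Omega -> 'rV[R]_n) (X : nat -> {mfun Omega >-> S})
  (w : nat -> {mfun Omega >-> 'rV[R]_n}).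

Lemma history_mono i j : (i <= j)%N -> history theta X w i `<=` history theta X w j.
Proof.
move=> ij; apply: sub_sigma_algebra2 => A [[k /= ki Ak]|[k /= ki Ak]].
  by left; exists k => //=; exact: leq_trans ki ij.
by right; exists k => //=; exact: leq_trans ki ij.
Qed.

Lemma history_iterate k (C : set 'rV[R]_n) : measurable C ->
  history theta X w k (theta k @^-1` C).
Proof.
move=> mC; apply: sub_sigma_algebra; left; exists k; first by rewrite /=.
by left; exists C => //; rewrite setTI.
Qed.

Lemma history_measurable k A : (forall i, measurable_fun setT (theta i)) ->
  history theta X w k A -> measurable A.
Proof.
move=> mth; apply: smallest_sub; first exact: sigma_algebra_measurable.
move=> B [[i _ [] [C mC <-]]|[i _ [C mC <-]]].
- exact: mth.
- exact: measurable_funPT.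
- exact: measurable_funPT.
Qed.

End history.

(** * Integrals over a set of full measure *)

Section integral_conull.
Context d (T : measurableType d) (R : realType) (Pr : probability T R).
Variable D : set T.
Hypotheses (mD : measurable D) (D1 : Pr (~` D) = 0%E).

Lemma integral_setI_conull A (f : T -> \bar R) : measurable A ->
  measurable_fun A f ->
  (\int[Pr]_(t in D `&` A) f t = \int[Pr]_(t in A) f t)%E.
Proof.
move=> mA mf; rewrite setIC.
have ge0 (g : T -> \bar R) : (forall t, 0 <= g t)%E -> measurable_fun A g ->
    (\int[Pr]_(t in A `&` D) g t = \int[Pr]_(t in A) g t)%E.
  move=> g0 mg; rewrite [RHS](ge0_negligible_integral _ _ _ _ D1)//.
  - by rewrite setDE setCK.
  - exact: measurableC.
rewrite integralE [RHS]integralE !ge0//.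
- exact: measurable_funeneg.
- exact: measurable_funepos.
Qed.

End integral_conull.

(** * The one-step recursion *)

Section stochastic_approximation.
Context (R : realType) (n : nat) dS (S : measurableType dS)
  (P : R.-pker S ~> S) (mu : probability S R)
  (F : S -> 'rV[R]_n -> 'rV[R]_n)
  dO (Omega : measurableType dO) (Pr : probability Omega R)
  (X : nat -> {mfun Omega >-> S}) (w : nat -> {mfun Omega >-> 'rV[R]_n})
  (alpha : nat -> R) (theta0 : 'rV[R]_n) (theta : nat -> Omega -> 'rV[R]_n)
  (L1 L2 c0 : R) (thetas : 'rV[R]_n) (D : set Omega).
Hypothesis mF : forall v, measurable_fun setT (F ^~ v).
Hypothesis alpha_gt0 : forall k, 0 < alpha k.
Hypothesis theta_init : forall om, theta 0%N om = theta0.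
Hypothesis theta_step : forall k om, theta k.+1 om =
  theta k om + alpha k *: (F (X k om) (theta k om) + w k om).
Hypothesis X_markov : markov_chain P Pr (history theta X w) X.
Hypothesis L1_gt0 : 0 < L1.
Hypothesis F_lip : forall x u v, norm2 (F x u - F x v) <= L1 * norm2 (u - v).
Hypothesis F_bnd : forall x, norm2 (F x 0) <= L1.
Hypothesis F_diss : forall v, dotv (v - thetas) (mean_field mu F v) <=
  - c0 * norm2 (v - thetas) ^+ 2.
Hypothesis w_mean0 : forall k,
  is_cond_exp_rV Pr (history theta X w k) (w k) (fun _ => 0).
Hypothesis L2_gt0 : 0 < L2.
Hypothesis mD : measurable D.
Hypothesis D_conull : Pr (~` D) = 0%E.
Hypothesis w_bnd : forall om, D om -> forall k,
  norm2 (w k om) <= L2 * (norm2 (theta k om) + 1).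

Local Notation G := (history theta X w).
Local Notation Fbar := (mean_field mu F).
Local Notation L := (L1 + L2).

Let L_gt0 : 0 < L. Proof. exact: addr_gt0. Qed.

Let mX k : measurable_fun setT (X k). Proof. exact: measurable_funPT. Qed.

Let mw k : measurable_fun setT (w k). Proof. exact: measurable_funPT. Qed.

Lemma measurable_iterate k : measurable_fun setT (theta k).
Proof.
elim: k => [|k IH].
  by rewrite (_ : theta 0%N = cst theta0); [exact: measurable_cst|exact/funext].
rewrite (_ : theta k.+1 = fun om =>
    theta k om + alpha k *: (F (X k om) (theta k om) + w k om)); last exact/funext.
apply: measurable_rVD => //; apply: measurable_rVZ; apply: measurable_rVD => //.
exact: (@measurable_field_comp _ _ _ _ F L1).
Qed.

Let mth := measurable_iterate.

Lemma update_le k om : D om ->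
  norm2 (F (X k om) (theta k om) + w k om) <= L * (norm2 (theta k om) + 1).
Proof.
move=> Dom; rewrite (le_trans (ler_norm2D _ _))// [leRHS]mulrDl lerD ?w_bnd//.
exact: field_growth.
Qed.

(** The start is deterministic and each update grows at most linearly. The bound depends on [k] and
    only serves integrability and the grid argument. *)
Lemma iterate_bounded k : exists B, forall om, D om -> norm2 (theta k om) <= B.
Proof.
elim: k => [|k [B HB]]; first by exists (norm2 theta0) => om _; rewrite theta_init.
exists (B + alpha k * (L * (B + 1))) => om Dom; rewrite theta_step.
rewrite (le_trans (ler_norm2D _ _))// lerD ?HB// norm2Z gtr0_norm//.
rewrite ler_wpM2l ?(ltW (alpha_gt0 k))//.
by rewrite (le_trans (update_le k Dom))// ler_wpM2l ?(ltW L_gt0)// lerD2r HB.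
Qed.

Let integral_le0 (A : set Omega) (f : Omega -> R) : measurable A ->
  measurable_fun setT f -> Pr.-integrable A (EFin \o f) ->
  \int[Pr]_(t in A) f t <= 0 ->
  (\int[Pr]_(t in D `&` A) (f t)%:E <= 0)%E.
Proof.
move=> mA mf iA f0.
rewrite integral_setI_conull//; last exact/measurable_EFinP/measurable_funTS.
by rewrite -[leLHS]fineK ?lee_fin//; exact: integrable_fin_num.
Qed.

Let mG k (C : set 'rV[R]_n) : measurable C -> measurable (theta k @^-1` C).
Proof. by move=> mC; rewrite -[X in measurable X]setTI; exact: mth. Qed.

Lemma noise_term_le0 k :
  Pr.-integrable D (EFin \o (fun om => dotv (theta k om - thetas) (w k om))) /\
  \int[Pr]_(om in D) dotv (theta k om - thetas) (w k om) <= 0.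
Proof.
have [B HB] := iterate_bounded k.
have wB t : D t -> norm2 (w k t) <= L2 * (B + 1).
  by move=> Dt; rewrite (le_trans (w_bnd Dt k))// ler_wpM2l ?(ltW L2_gt0)// lerD2r HB.
have mZ v : measurable_fun setT (fun t => dotv (v - thetas) (w k t)).
  by apply: measurable_dotv => //; exact: measurable_cst.
apply: (@Rintegral_subst_le0 _ _ _ _ (theta k)
  (fun v t => dotv (v - thetas) (w k t)) (mth k) mZ Pr D B (L2 * (B + 1))
  ((B + n%:R + norm2 thetas) * (L2 * (B + 1)))) => //.
- apply: measurable_dotv => //; apply: measurable_rVB => //.
- move=> v v' t Dt _ _; rewrite -dotvBl opprB addrA subrK mulrC.
  by rewrite (le_trans (abs_dotv_le _ _))// ler_wpM2l ?norm2_ge0 ?wB.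
- move=> v t Dt vB; rewrite (le_trans (abs_dotv_le _ _))// ler_pM ?norm2_ge0 ?wB//.
  by rewrite (le_trans (ler_norm2D _ _))// norm2N lerD2r.
move=> v C mC; have mA := mG k mC.
have iw i : Pr.-integrable (theta k @^-1` C) (EFin \o (fun t => w k t 0 i)).
  have [_ iw _ _] := w_mean0 k i.
  exact: (integrableS measurableT).
have iuw i : Pr.-integrable (theta k @^-1` C)
    (EFin \o (fun t => (v - thetas) 0 i * w k t 0 i)).
  rewrite (_ : _ \o _ =
      (fun x => ((v - thetas) 0%R i)%:E * (EFin \o (fun t => (w k t 0 i)%R)) x)%E).
    exact: integrableZl.
  by apply/funext => x; rewrite /= EFinM.
have [isum E] := Rintegral_sum (index_enum 'I_n) mA iuw.
apply: integral_le0 => //; rewrite E big1// => i _.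
rewrite RintegralZl// /Rintegral.
have [_ _ _ <-] := w_mean0 k i; last exact: history_iterate.
by rewrite integral0_eq ?mulr0// => t _; rewrite mxE.
Qed.

(** Bias at [theta m] of the noise [s] steps later, minus the allowance that mixing gives it. The
    two [+ 1] make the allowance positive for every frozen parameter, as the mixing estimate
    requires a positive bound. *)
Let markov_term m s e om :=
  dotv (theta m om - thetas)
    (F (X (m + s)%N om) (theta m om) - Fbar (theta m om)) -
  2 * e * L1 * ((norm2 (theta m om - thetas) + 1) * (norm2 (theta m om) + 1)).

(** For a frozen parameter and an event of the past at time [m], this is the mixing estimate; the
    grid then restores [theta m]. *)
Lemma markov_term_le0 m s (e : R) : 0 <= e -> (sup_tv P mu s <= e%:E)%E ->
  Pr.-integrable D (EFin \o markov_term m s e) /\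
  \int[Pr]_(om in D) markov_term m s e om <= 0.
Proof.
move=> e0 tve; have [B HB] := iterate_bounded m.
pose Z v t := dotv (v - thetas) (F (X (m + s)%N t) v - Fbar v) -
  2 * e * L1 * ((norm2 (v - thetas) + 1) * (norm2 v + 1)).
have dev u v t : `|dotv u (F (X (m + s)%N t) v - Fbar v)| <=
    norm2 u * (2 * L1 * (norm2 v + 1)).
  rewrite (le_trans (abs_dotv_le _ _))// ler_wpM2l ?norm2_ge0//.
  rewrite (le_trans (ler_norm2D _ _))// norm2N.
  have := field_growth F_lip F_bnd (X (m + s)%N t) v.
  by have := mean_field_growth mu mF L1_gt0 F_lip F_bnd v; lra.
have dev2 u v v' t : `|dotv u ((F (X (m + s)%N t) v - Fbar v) -
    (F (X (m + s)%N t) v' - Fbar v'))| <= norm2 u * (2 * L1 * norm2 (v - v')).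
  rewrite (le_trans (abs_dotv_le _ _))// ler_wpM2l ?norm2_ge0//.
  rewrite [X in norm2 X](_ : _ = (F (X (m + s)%N t) v - F (X (m + s)%N t) v') -
    (Fbar v - Fbar v')); last by apply/rowP => i; rewrite !mxE; ring.
  rewrite (le_trans (ler_norm2D _ _))// norm2N.
  have := F_lip (X (m + s)%N t) v v'.
  by have := mean_field_lip mu mF L1_gt0 F_lip F_bnd v v'; lra.
have mf v : measurable_fun setT (fun t => dotv (v - thetas) (F (X (m + s)%N t) v)).
  apply: (@measurableT_comp _ _ _ _ _ _ (fun x => dotv (v - thetas) (F x v))) => //.
  exact: measurable_dotv_field.
have mZ v : measurable_fun setT (Z v).
  apply: measurable_funB; last exact: measurable_cst.
  under eq_fun do rewrite dotvBr.
  by apply: measurable_funB => //; exact: measurable_cst.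
have mZth : measurable_fun setT (fun t => Z (theta m t) t).
  apply: measurable_funB.
    apply: measurable_dotv; first by apply: measurable_rVB.
    apply: measurable_rVB; first exact: (@measurable_field_comp _ _ _ _ F L1).
    exact: (@measurable_mean_field_comp _ _ _ _ mu F L1).
  apply: measurable_funM => //; apply: measurable_funM.
    by apply: measurable_funD => //; apply: measurable_norm2; exact: measurable_rVB.
  by apply: measurable_funD => //; exact: measurable_norm2.
pose B' := B + n%:R; pose B1 := B' + norm2 thetas.
have vB1 v : norm2 v <= B' -> norm2 (v - thetas) <= B1.
  by move=> vB; rewrite (le_trans (ler_norm2D _ _))// norm2N lerD2r.
pose c := 2 * e * L1.
have c_ge0 : 0 <= c by rewrite !mulr_ge0 // ltW.
(* Crude Lipschitz constant and bound for [Z] on the ball of radius [B']; only their finiteness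
   matters. *)
apply: (@Rintegral_subst_le0 _ _ _ _ (theta m) Z (mth m) mZ Pr D B
  (2 * L1 * (B' + 1) + 2 * L1 * B1 + c * (B' + 1 + (B1 + 1)))
  (B1 * (2 * L1 * (B' + 1)) + c * ((B1 + 1) * (B' + 1)))) => //.
- move=> v v' t Dt vB v'B.
  have vv := norm2_ge0 (v - v').
  (* The factors of each product are changed from [v] to [v'] one at a time. *)
  have -> : Z v t - Z v' t =
      dotv (v - v') (F (X (m + s)%N t) v - Fbar v) +
      dotv (v' - thetas) ((F (X (m + s)%N t) v - Fbar v) -
        (F (X (m + s)%N t) v' - Fbar v')) -
      c * ((norm2 (v - thetas) - norm2 (v' - thetas)) * (norm2 v + 1) +
           (norm2 (v' - thetas) + 1) * (norm2 v - norm2 v')).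
    by rewrite /Z !dotvBr !dotvBl /c; ring.
  have h1 := dev (v - v') v t; have h2 := dev2 (v' - thetas) v v' t.
  have h3 := ler_dist_norm2 (v - thetas) (v' - thetas).
  rewrite opprB addrA subrK in h3.
  have h4 := ler_dist_norm2 v v'.
  rewrite (le_trans (ler_normB _ _))// [leRHS]mulrDl lerD//.
    rewrite (le_trans (ler_normD _ _))// [leRHS]mulrDl lerD//.
      rewrite (le_trans h1)// mulrC ler_wpM2r// ler_wpM2l ?lerD2r//.
      by rewrite mulr_ge0 ?ltW.
    rewrite (le_trans h2)// mulrCA mulrA ler_wpM2r// ler_wpM2l ?vB1//.
    by rewrite mulr_ge0 ?ltW.
  rewrite normrM (ger0_norm c_ge0) -mulrA ler_wpM2l//.
  rewrite (le_trans (ler_normD _ _))// [leRHS]mulrDl lerD// normrM.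
    rewrite mulrC ler_pM// ger0_norm ?lerD2r// addr_ge0 ?norm2_ge0//.
  by rewrite ler_pM// ger0_norm ?lerD2r ?vB1// addr_ge0 ?norm2_ge0.
- move=> v t Dt vB; rewrite (le_trans (ler_normB _ _))// lerD//.
    rewrite (le_trans (dev _ _ _))// ler_pM ?norm2_ge0 ?vB1//.
      by rewrite !mulr_ge0 ?addr_ge0 ?norm2_ge0 ?ltW.
    by rewrite ler_wpM2l ?lerD2r// mulr_ge0 ?ltW.
  rewrite ger0_norm ?ler_wpM2l//; last first.
    by rewrite mulr_ge0// mulr_ge0 ?addr_ge0 ?norm2_ge0.
  by rewrite ler_pM ?addr_ge0 ?norm2_ge0 ?lerD2r ?vB1.
move=> v C mC; have mA := mG m mC.
pose M := L1 * ((norm2 (v - thetas) + 1) * (norm2 v + 1)).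
have M_gt0 : 0 < M by rewrite !mulr_gt0// ltr_wpDl ?norm2_ge0.
have fM x : `|dotv (v - thetas) (F x v)| <= M.
  rewrite (le_trans (abs_dotv_field F_lip F_bnd _ _ _))// /M mulrCA.
  rewrite ler_wpM2l ?(ltW L1_gt0)// ler_wpM2r ?lerDl//.
  by rewrite addr_ge0 ?norm2_ge0.
have if_ : Pr.-integrable (theta m @^-1` C)
    (EFin \o (fun t => dotv (v - thetas) (F (X (m + s)%N t) v))).
  by apply: (@le_bounded_integrable _ _ _ _ _ _ M).
pose r := dotv (v - thetas) (Fbar v) + 2 * e * M.
have ZE : Z v = fun t => dotv (v - thetas) (F (X (m + s)%N t) v) - r.
  by apply/funext => t; rewrite /Z /r dotvBr /M; ring.
have ir : Pr.-integrable (theta m @^-1` C) (EFin \o cst r).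
  by apply: (@le_bounded_integrable _ _ _ _ _ _ `|r|).
apply: integral_le0 => //.
  rewrite ZE (_ : _ \o _ = (EFin \o (fun t => dotv (v - thetas)
    (F (X (m + s)%N t) v))) \- (EFin \o cst r))%E//.
  exact: integrableB.
rewrite ZE RintegralB// Rintegral_cst// subr_le0.
have GA : G m (theta m @^-1` C) by exact: history_iterate.
have mGi i A : G i A -> measurable A by exact: history_measurable.
have G_mono i j : (i <= j)%N -> G i `<=` G j by exact: history_mono.
have := mixing_Rintegral G_mono mGi X_markov tve GA M_gt0
  (measurable_dotv_field mF _ _) fM.
rewrite -(dotv_mean_field mu mF F_lip F_bnd) /r.
by rewrite (mulrAC 2 M e) mulrC.
Qed.

(** While [L] times the elapsed stepsizes is at most 1/2, [norm2 (theta _ om) + 1] at most doubles,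
    so each further step moves by at most [2 * L * alpha l] times its initial value. *)
Lemma path_drift m i om : D om ->
  L * (\sum_(m <= l < m + i) alpha l) <= 1 / 2 ->
  norm2 (theta (m + i)%N om - theta m om) <=
  2 * (L * \sum_(m <= l < m + i) alpha l) * (norm2 (theta m om) + 1).
Proof.
move=> Dom; elim: i => [|i IH].
  by rewrite addn0 big_geq// subrr norm2_0 !mulr0 mul0r.
rewrite addnS big_nat_recr/= ?leq_addr// mulrDr => La.
have La0 : 0 <= L * alpha (m + i)%N by rewrite mulr_ge0 ?ltW.
have S0 : 0 <= L * (\sum_(m <= l < m + i) alpha l).
  by rewrite mulr_ge0 ?(ltW L_gt0)// sumr_ge0// => l _; exact: ltW.
have {}IH := IH ltac:(lra).
have um := norm2_ge0 (theta m om).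
have hu : norm2 (theta (m + i)%N om) + 1 <= 2 * (norm2 (theta m om) + 1).
  have := ler_norm2B (theta (m + i)%N om) (theta m om).
  move: IH; set z := norm2 (_ - _); set Sg := L * _ in La S0 *; nra.
have hs : norm2 (theta (m + i).+1 om - theta (m + i)%N om) <=
    L * alpha (m + i)%N * (2 * (norm2 (theta m om) + 1)).
  rewrite theta_step addrC addKr norm2Z gtr0_norm// (mulrC L) -mulrA.
  rewrite ler_wpM2l ?(ltW (alpha_gt0 _))//.
  by rewrite (le_trans (update_le _ Dom))// ler_wpM2l ?(ltW L_gt0).
rewrite -(subrK (theta (m + i)%N om) (theta (m + i).+1 om)) -addrA.
rewrite (le_trans (ler_norm2D _ _))//; move: IH hs; lra.
Qed.

Local Notation b := (norm2 thetas + 1).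

(** Pathwise, before any mean is taken: every remainder is measured in units of
    [Q = L ^+ 2 * M * y ^+ 2], where [y] dominates [norm2 tk + 1]. The last line keeps the two terms
    whose means are nonpositive. *)
Lemma path_step k s (e M : R) om : D om -> (s <= k)%N -> 1 <= L -> c0 <= L ->
  0 <= e <= M -> \sum_(k - s <= l < k) alpha l <= M -> alpha k <= M ->
  130 * L ^+ 2 * M <= c0 ->
  norm2 (theta k.+1 om - thetas) ^+ 2 <=
  (1 - c0 * alpha k) * norm2 (theta k om - thetas) ^+ 2 +
  130 * L ^+ 2 * b ^+ 2 * (alpha k * M) +
  2 * alpha k *
  (markov_term (k - s) s e om + dotv (theta k om - thetas) (w k om)).
Proof.
move=> Dom sk L_ge1 c0L /andP[e0 eM] WM aM LM.
have M0 : 0 < M by rewrite (lt_le_trans (alpha_gt0 k)).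
have LM130 : 130 * (L * M) <= 1.
  have := le_trans LM c0L; rewrite expr2 => h.
  by rewrite -(ler_pM2l L_gt0); lra.
have drift : norm2 (theta k om - theta (k - s) om) <=
    2 * (L * M) * (norm2 (theta (k - s) om) + 1).
  have LW : L * (\sum_(k - s <= l < k - s + s) alpha l) <= L * M.
    by rewrite ler_wpM2l ?(ltW L_gt0)// subnK.
  have := @path_drift (k - s) s om Dom; rewrite {2}subnK// => h.
  apply: le_trans (h _) _; first by rewrite (le_trans LW)//; lra.
  by rewrite ler_wpM2r ?addr_ge0 ?norm2_ge0// ler_wpM2l.
rewrite /markov_term subnK//; move: drift.
set tk := theta k om; set tm := theta (k - s) om; set Xk := X k om.
set x := norm2 (tk - thetas); set xm := norm2 (tm - thetas).
set um := norm2 tm + 1; set Dd := norm2 (tk - tm) => drift.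
have x0 : 0 <= x := norm2_ge0 _.
have xm0 : 0 <= xm := norm2_ge0 _.
have Dd0 : 0 <= Dd := norm2_ge0 _.
have um0 : 0 <= um by rewrite addr_ge0 ?norm2_ge0.
have b1 : 1 <= b by rewrite lerDr norm2_ge0.
pose y := x + b; pose Q := L ^+ 2 * M * y ^+ 2.
have LM0 : 0 <= L * M by rewrite mulr_ge0 ?ltW.
have yE : y = x + b by [].
have y1 : 1 <= y by lra.
have uy : norm2 tk + 1 <= y.
  by rewrite /y /x; have := ler_norm2B tk thetas; lra.
have u0 := norm2_ge0 tk.
have umD : um <= norm2 tk + 1 + Dd.
  by rewrite /um /Dd norm2BC; have := ler_norm2B tm tk; lra.
have Dum : Dd <= 2 / 130 * um.
  by rewrite (le_trans drift)// ler_wpM2r//; lra.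
(* [Dd] is at most [um / 65], so [um <= y + um / 65], which gives the ratio 65/64 used
   throughout. *)
have umy : um <= 65 / 64 * y by lra.
have Dy : Dd <= 65 / 32 * (L * M) * y.
  rewrite (le_trans drift)//.
  have -> : 65 / 32 * (L * M) * y = 2 * (L * M) * (65 / 64 * y) by field.
  by rewrite ler_wpM2l// mulr_ge0.
have xmy : xm + 1 <= 65 / 64 * y.
  have : xm <= x + Dd.
    have := ler_norm2D (tm - tk) (tk - thetas).
    by rewrite subrKA (norm2BC tm tk) -/xm -/x -/Dd; lra.
  by lra.
have L1L : L1 <= L by rewrite lerDl ltW.
have y0 : 0 <= y by lra.
have fk : norm2 (F Xk tk - Fbar tk) <= 2 * L * y.
  rewrite (le_trans (ler_norm2D _ _))// norm2N.
  have := field_growth F_lip F_bnd Xk tk.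
  have := mean_field_growth mu mF L1_gt0 F_lip F_bnd tk.
  have : L1 * (norm2 tk + 1) <= L * y by rewrite ler_pM// ?(ltW L1_gt0); lra.
  by lra.
have fd : norm2 (F Xk tk - Fbar tk - (F Xk tm - Fbar tm)) <= 2 * L * Dd.
  rewrite [X in norm2 X](_ : _ = (F Xk tk - F Xk tm) - (Fbar tk - Fbar tm));
    last by apply/rowP => i; rewrite !mxE; ring.
  rewrite (le_trans (ler_norm2D _ _))// norm2N.
  have := F_lip Xk tk tm.
  have := mean_field_lip mu mF L1_gt0 F_lip F_bnd tk tm; rewrite -/Dd.
  have : L1 * Dd <= L * Dd by rewrite ler_wpM2r.
  by lra.
have T1 : dotv (tk - tm) (F Xk tk - Fbar tk) <= 65 / 16 * Q.
  rewrite (le_trans (dotv_le _ _))// -/Dd.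
  have -> : 65 / 16 * Q = (65 / 32 * (L * M) * y) * (2 * L * y).
    by rewrite /Q; field.
  by rewrite ler_pM ?norm2_ge0.
have T2 : dotv (tm - thetas) (F Xk tk - Fbar tk - (F Xk tm - Fbar tm)) <=
    65 / 64 * (65 / 16) * Q.
  rewrite (le_trans (dotv_le _ _))// -/xm.
  have -> : 65 / 64 * (65 / 16) * Q =
      (65 / 64 * y) * (2 * L * (65 / 32 * (L * M) * y)) by rewrite /Q; field.
  rewrite ler_pM ?norm2_ge0//; first by lra.
  by rewrite (le_trans fd)// ler_wpM2l// mulr_ge0 ?(ltW L_gt0).
have T3 : 2 * e * L1 * ((xm + 1) * um) <= 2 * (65 / 64) ^+ 2 * Q.
  (* One factor [L] is added by [1 <= L], to match the [L ^+ 2] in [Q]. *)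
  have eL : e * L1 <= M * L * L.
    rewrite (@le_trans _ _ (M * L))//; first by rewrite ler_pM ?(ltW L1_gt0).
    by rewrite ler_peMr// mulr_ge0 ?(ltW M0) ?(ltW L_gt0).
  have xu : (xm + 1) * um <= 65 / 64 * y * (65 / 64 * y).
    by rewrite ler_pM// addr_ge0.
  have -> : 2 * (65 / 64) ^+ 2 * Q =
      2 * (M * L * L * (65 / 64 * y * (65 / 64 * y))) by rewrite /Q; field.
  rewrite -(mulrA 2) -mulrA ler_wpM2l// ler_pM//.
    by rewrite mulr_ge0 ?(ltW L1_gt0).
  by rewrite mulr_ge0// addr_ge0.
have N2 : alpha k * norm2 (F Xk tk + w k om) ^+ 2 <= Q.
  have -> : Q = M * (L * y) ^+ 2 by rewrite /Q; field.
  rewrite ler_pM ?(ltW (alpha_gt0 k)) ?sqr_ge0//.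
  rewrite ler_pXn2r ?nnegrE ?norm2_ge0 ?mulr_ge0 ?(ltW L_gt0)//.
  by rewrite (le_trans (update_le k Dom))// ler_wpM2l ?(ltW L_gt0).
(* Twice the bounds [T1], [T2], [T3], plus [N2], total less than [22 * Q], and
   [y ^+ 2 <= 2 * (x ^+ 2 + b ^+ 2)]. The part in [x] costs at most one of the two units
   [c0 * x ^+ 2] of drift. *)
have Qxb : 44 * (L ^+ 2 * M) * (x ^+ 2 + b ^+ 2) >= 22 * Q.
  rewrite /Q /y; have := sqr_ge0 (x - b).
  have : 0 <= L ^+ 2 * M by rewrite mulr_ge0 ?sqr_ge0 ?ltW.
  move: (L ^+ 2 * M) => q q0 xb; have := mulr_ge0 q0 xb; nra.
have Qx : 44 * (L ^+ 2 * M) * x ^+ 2 <= c0 * x ^+ 2.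
  rewrite ler_wpM2r ?sqr_ge0// (le_trans _ LM)//.
  have : 0 <= L ^+ 2 * M by rewrite mulr_ge0 ?sqr_ge0 ?ltW.
  by lra.
have Qb : 44 * (L ^+ 2 * M) * b ^+ 2 <= 130 * L ^+ 2 * b ^+ 2 * M.
  have : 0 <= L ^+ 2 * M * b ^+ 2.
    by rewrite mulr_ge0 ?sqr_ge0// mulr_ge0 ?sqr_ge0 ?(ltW M0).
  by lra.
have diss := F_diss tk; rewrite -/x in diss.
have key : 2 * dotv (tk - thetas) (F Xk tk + w k om) +
    alpha k * norm2 (F Xk tk + w k om) ^+ 2 <=
    - c0 * x ^+ 2 + 130 * L ^+ 2 * b ^+ 2 * M +
    2 * ((dotv (tm - thetas) (F Xk tm - Fbar tm) -
      2 * e * L1 * ((xm + 1) * um)) + dotv (tk - thetas) (w k om)).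
  (* The bias at [tk] is moved to [tm], first in the left factor and then in the field. *)
  have -> : dotv (tk - thetas) (F Xk tk + w k om) =
      dotv (tk - thetas) (Fbar tk) + dotv (tk - tm) (F Xk tk - Fbar tk) +
      dotv (tm - thetas) (F Xk tk - Fbar tk - (F Xk tm - Fbar tm)) +
      dotv (tm - thetas) (F Xk tm - Fbar tm) + dotv (tk - thetas) (w k om).
    by rewrite !(dotvBl, dotvBr, dotvDr); ring.
  have Q0 : 0 <= Q by rewrite mulr_ge0 ?sqr_ge0// mulr_ge0 ?sqr_ge0 ?(ltW M0).
  lra.
rewrite theta_step -/tk -/Xk addrAC norm2_sqrD -/x dotvZr norm2Z.
rewrite (gtr0_norm (alpha_gt0 k)) exprMn.
have := ler_wpM2l (ltW (alpha_gt0 k)) key.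
by move: (norm2 (F Xk tk + w k om) ^+ 2) => N; lra.
Qed.

Lemma integrable_error k :
  Pr.-integrable D (EFin \o (fun om => norm2 (theta k om - thetas) ^+ 2)).
Proof.
have [B HB] := iterate_bounded k.
apply: (@le_bounded_integrable _ _ _ _ _ _ ((B + norm2 thetas) ^+ 2)) => //.
  by apply: measurable_funX; apply: measurable_norm2; exact: measurable_rVB.
move=> om Dom; rewrite ger0_norm ?sqr_ge0//.
have xB : norm2 (theta k om - thetas) <= B + norm2 thetas.
  by rewrite (le_trans (ler_norm2D _ _))// norm2N lerD2r HB.
by rewrite ler_pXn2r ?nnegrE ?norm2_ge0 ?(le_trans (norm2_ge0 _) xB).
Qed.

(** Taken over [D], where the noise bound holds at all times, so that pathwise inequalities can be
    integrated. *)
Let mean_sq_error k := \int[Pr]_(om in D) norm2 (theta k om - thetas) ^+ 2.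

Lemma expectation_error k :
  ('E_Pr[fun om => (norm2 (theta k om - thetas) ^+ 2)%R] =
   (mean_sq_error k)%:E)%E.
Proof.
rewrite unlock -(integral_setI_conull mD D_conull)//.
  by rewrite setIT /mean_sq_error /Rintegral fineK//;
    exact/integrable_fin_num/integrable_error.
apply/measurable_EFinP.
by apply: measurable_funX; apply: measurable_norm2; exact: measurable_rVB.
Qed.

Let PrD_le1 : fine (Pr D) <= 1.
Proof.
by rewrite -lee_fin fineK ?fin_num_measure// probability_le1.
Qed.

Lemma mean_sq_error_step k s (e M : R) : (s <= k)%N -> 1 <= L -> c0 <= L ->
  (sup_tv P mu s <= e%:E)%E ->
  0 <= e <= M -> \sum_(k - s <= l < k) alpha l <= M -> alpha k <= M ->
  130 * L ^+ 2 * M <= c0 ->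
  mean_sq_error k.+1 <= (1 - c0 * alpha k) * mean_sq_error k +
    130 * L ^+ 2 * b ^+ 2 * (alpha k * M).
Proof.
move=> sk L_ge1 c0L tve eM WM aM LM; have /andP[e0 e_M] := eM.
have [iZ Z0] := markov_term_le0 (k - s) e0 tve.
have [iN N0] := noise_term_le0 k.
have iE := integrable_error k.
pose c := 130 * L ^+ 2 * b ^+ 2 * (alpha k * M).
have c_ge0 : 0 <= c.
  rewrite mulr_ge0//; first by rewrite mulr_ge0 ?sqr_ge0// mulr_ge0 ?sqr_ge0.
  by rewrite mulr_ge0 ?(ltW (alpha_gt0 k)) ?(le_trans e0 e_M).
have ic : Pr.-integrable D (EFin \o cst c).
  by apply: (@le_bounded_integrable _ _ _ _ _ _ `|c|).
have iD f g : Pr.-integrable D (EFin \o f) -> Pr.-integrable D (EFin \o g) ->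
    Pr.-integrable D (EFin \o (fun om => f om + g om)).
  move=> i_f ig; rewrite (_ : _ \o _ = (EFin \o f) \+ (EFin \o g))%E//.
  exact: integrableD.
have iM a f : Pr.-integrable D (EFin \o f) ->
    Pr.-integrable D (EFin \o (fun om => a * f om)).
  move=> i_f; rewrite (_ : _ \o _ = (fun om => a%:E * (EFin \o f) om)%E).
    exact: integrableZl.
  by apply/funext => om; rewrite /= EFinM.
apply: (@le_trans _ _ (\int[Pr]_(om in D)
    ((1 - c0 * alpha k) * norm2 (theta k om - thetas) ^+ 2 + c +
     2 * alpha k *
     (markov_term (k - s) s e om + dotv (theta k om - thetas) (w k om))))).
  apply: le_Rintegral => //; first exact: integrable_error.
    by apply: (iD _ _ (iD _ _ (iM _ _ iE) ic)); apply: iM; exact: iD.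
  by move=> om Dom; exact: path_step.
rewrite RintegralD//; [|by apply: iD => //; exact: iM|by apply: iM; exact: iD].
rewrite RintegralD//; [|exact: iM].
have -> : \int[Pr]_(om in D)
    ((1 - c0 * alpha k) * norm2 (theta k om - thetas) ^+ 2) =
    (1 - c0 * alpha k) * mean_sq_error k by exact: RintegralZl.
rewrite [X in _ + X <= _](_ : _ = 2 * alpha k * \int[Pr]_(om in D)
    (markov_term (k - s) s e om + dotv (theta k om - thetas) (w k om))); last first.
  by apply: RintegralZl => //; exact: iD.
rewrite RintegralD// Rintegral_cst// -/c.
have : c * fine (Pr D) <= c by rewrite ler_piMr.
have a0 := alpha_gt0 k.
have : 2 * alpha k * (\int[Pr]_(om in D) markov_term (k - s) s e om +
    \int[Pr]_(om in D) dotv (theta k om - thetas) (w k om)) <= 0.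
  by rewrite pmulr_rle0 ?mulr_gt0//; lra.
by lra.
Qed.

(** Up to time [K] the path moves by at most [norm2 theta0 + 1], by the drift bound from time 0; the
    triangle inequality does the rest. *)
Lemma mean_sq_error_init K : L * (\sum_(0 <= l < K) alpha l) <= 1 / 2 ->
  mean_sq_error K <= (norm2 theta0 + norm2 (theta0 - thetas) + 1) ^+ 2.
Proof.
move=> LW; set beta := norm2 theta0 + norm2 (theta0 - thetas) + 1.
have beta0 : 0 <= beta by rewrite !addr_ge0 ?norm2_ge0.
apply: (@le_trans _ _ (\int[Pr]_(om in D) (beta ^+ 2))).
  apply: le_Rintegral => //; first exact: integrable_error.
    by apply: (@le_bounded_integrable _ _ _ _ _ _ `|beta ^+ 2|).
  move=> om Dom; rewrite ler_pXn2r ?nnegrE ?norm2_ge0//.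
  have := @path_drift 0 K om Dom LW; rewrite add0n theta_init => h.
  have h2 : norm2 (theta K om - theta0) <= norm2 theta0 + 1.
    apply: le_trans h _; rewrite ler_piMl ?addr_ge0 ?norm2_ge0//; lra.
  have := ler_norm2B (theta K om - thetas) (theta0 - thetas).
  by rewrite opprB addrA subrK /beta; lra.
by rewrite Rintegral_cst// ler_piMr ?sqr_ge0.
Qed.

End stochastic_approximation.

(** * Mixing times and stepsizes *)

Section mixing_time.
Context dS (S : measurableType dS) (R : realType).
Variables (P : R.-pker S ~> S) (mu : probability S R).

(** Once some lag is admissible, the default value 0 of [mixing_time] is out of play. *)
Lemma mixing_timeP (e : R) : (exists k, (sup_tv P mu k <= e%:E)%E) ->
  is_least [set k | (sup_tv P mu k <= e%:E)%E] (mixing_time P mu e).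
Proof.
move=> [k ke]; apply: (@xgetPex _ 0%N (is_least _)).
have ex : exists k, `[< (sup_tv P mu k <= e%:E)%E >] by exists k; apply/asboolP.
case: (ex_minnP ex) => m /asboolP me mmin.
by exists m; split => // j je; apply: mmin; exact/asboolP.
Qed.

Lemma geometric_mixing (C rho : R) : 0 < rho -> rho < 1 ->
  (forall k, (sup_tv P mu k <= (C * rho ^+ k)%:E)%E) ->
  forall e : R, 0 < e -> exists k, (sup_tv P mu k <= e%:E)%E.
Proof.
move=> rho0 rho1 erg e e0.
have rho_lt1 : `|rho| < 1 by rewrite gtr0_norm.
have /cvgrPdist_le/(_ e e0) [N _ HN] := cvg_geometric C rho_lt1.
exists N; apply: le_trans (erg N) _; rewrite lee_fin.
have := HN N (leqnn N); rewrite /geometric/= sub0r normrN.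
exact: le_trans (ler_norm _).
Qed.

End mixing_time.

(** Two windows of the same length [s], compared term by term after reindexing from 0. *)
Lemma nonincreasing_shift_sum (R : realType) (alpha : nat -> R) (s i k : nat) :
  (forall j, alpha j.+1 <= alpha j) -> (s <= i)%N -> (i <= k)%N ->
  \sum_(k - s <= l < k) alpha l <= \sum_(i - s <= l < i) alpha l.
Proof.
move=> dec si ik; have sk := leq_trans si ik.
rewrite -{1}[(k - s)%N]add0n -{1}[(i - s)%N]add0n !big_addn !subKn//.
apply: ler_sum => j _.
by apply: (nonincreasing_seqP alpha).1 => //; rewrite leq_add2l leq_sub2r.
Qed.

(** * Choice of the lag and its stepsize window *)

Section lag.
Context (R : realType) (dS : measure_display) (S : measurableType dS).
Variables (P : R.-pker S ~> S) (mu : probability S R) (alpha : nat -> R) (c : R).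
Hypothesis alpha_gt0 : forall k, 0 < alpha k.
Hypothesis alpha_dec : forall k, alpha k.+1 <= alpha k.
Hypothesis mixes : forall e : R, 0 < e -> exists k, (sup_tv P mu k <= e%:E)%E.

Let t k := mixing_time P mu (alpha k).
Hypothesis t0_gt0 : (0 < t 0)%N.
Hypothesis window_lt : forall k, (t k <= k)%N -> alpha_window alpha t k < c.
Variable K : nat.
Hypothesis leastK : is_least [set k | (t k <= k)%N] K.

Let alpha_le i j : (i <= j)%N -> alpha j <= alpha i.
Proof. by move/nonincreasing_seqP : alpha_dec => /[apply]. Qed.

Let tvt k : (sup_tv P mu (t k) <= (alpha k)%:E)%E.
Proof. by have [] := mixing_timeP (mixes (alpha_gt0 k)). Qed.

Let t_le i j : (i <= j)%N -> (t i <= t j)%N.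
Proof.
move=> ij; have [_] := mixing_timeP (mixes (alpha_gt0 i)); apply => /=.
by rewrite (le_trans (tvt j))// lee_fin alpha_le.
Qed.

Let t_gt0 k : (0 < t k)%N. Proof. exact: leq_trans t0_gt0 (t_le (leq0n k)). Qed.

(** If [t K] were less than [K = K'.+1], monotonicity of [t] would give [t K' <= K'], against
    minimality. Hence the window at [K] consists of all stepsizes before [K]. *)
Lemma first_time_mixing_time : t K = K.
Proof.
have [/= tK Kmin] := leastK; apply/eqP; rewrite eqn_leq tK/=.
case EK : K => [//|K']; rewrite -EK leqNgt; apply/negP => tKK.
have : (K <= K')%N.
  apply: Kmin => /=; rewrite -ltnS -EK.
  by apply: leq_ltn_trans tKK; rewrite t_le// EK.
by rewrite EK ltnn.
Qed.

Lemma first_window_lt : \sum_(0 <= l < K) alpha l < c.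
Proof.
have [tK _] := leastK; have := window_lt tK.
by rewrite /alpha_window first_time_mixing_time subnn.
Qed.

Let last_step_le i k : (i < k)%N -> alpha k <= \sum_(i <= l < k) alpha l.
Proof.
case: k => // k; rewrite ltnS => ik; rewrite big_nat_recr//=.
rewrite (le_trans (alpha_le (leqnSn k)))// lerDr.
by apply: sumr_ge0 => l _; exact: ltW.
Qed.

(* If [t k > k], which a steep drop of the stepsizes after time [K] can cause,
   the lag [K] replaces [t k]: then [alpha_window] starts at 0, so that it
   dominates both [alpha K] and the sum over the lag. *)
Lemma admissible_lag k : (K <= k)%N -> exists s (e M : R),
  [/\ (s <= k)%N, (sup_tv P mu s <= e%:E)%E, 0 <= e <= M,
      \sum_(k - s <= l < k) alpha l <= M & [/\ alpha k <= M, M < c &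
      M <= alpha_window alpha t k]].
Proof.
move=> Kk; have [tk|tk] := leqP (t k) k.
  (* [t k > 0] makes the window nonempty, and its last term already dominates [alpha k]. *)
  have ak : alpha k <= alpha_window alpha t k.
    by apply: last_step_le; rewrite ltn_subrL t_gt0 (leq_trans (t_gt0 k)).
  exists (t k), (alpha k), (alpha_window alpha t k); split => //.
    by rewrite (ltW (alpha_gt0 k)).
  by split => //; exact: window_lt.
have KltK : (K < k)%N.
  rewrite ltn_neqAle Kk andbT; apply/eqP => Kk'.
  by move: tk; rewrite -Kk' first_time_mixing_time ltnn.
have K0 : (0 < K)%N by rewrite -first_time_mixing_time t_gt0.
pose W := \sum_(k - K <= l < k) alpha l.
have W0 : 0 <= W by apply: sumr_ge0 => l _; exact: ltW.
(* [M] has to dominate both the sum over the lag and the precision [alpha K] that the lag [K = t K]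
   achieves. *)
exists K, (alpha K), (Num.max W (alpha K)); split => //.
- by rewrite -{1}first_time_mixing_time tvt.
- by rewrite (ltW (alpha_gt0 K)) le_max lexx orbT.
- by rewrite le_max lexx.
split.
- by rewrite le_max (alpha_le Kk) orbT.
(* Both entries are at most the sum before [K]: [W] is a later window of the same length, and
   [alpha K] is at most the last term. *)
- rewrite gt_max; apply/andP; split; apply: le_lt_trans first_window_lt.
    by rewrite -(subnn K); exact: nonincreasing_shift_sum.
  exact: last_step_le.
rewrite ge_max /alpha_window (_ : (k - t k)%N = 0%N); last first.
  by apply/eqP; rewrite subn_eq0 ltnW.
apply/andP; split.
  rewrite [leRHS](@big_cat_nat _ _ _ (k - K))//= ?leq_subr// lerDr.
  by apply: sumr_ge0 => l _; exact: ltW.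
(* As [K < k], [alpha K] is itself a term of the sum from 0. *)
rewrite (@big_cat_nat _ _ _ K)//= [X in _ + X]big_ltn// addrCA lerDl.
by rewrite addr_ge0// sumr_ge0// => l _; exact: ltW.
Qed.

End lag.

(** Discrete Gronwall: the recursion is unrolled from [K], the nonnegative factors preserving the
    inequality at each step. *)
Lemma linear_recursion (R : realFieldType) (v a h : nat -> R) (c beta1 beta2 : R)
    (K k : nat) :
  (forall j, (K <= j)%N -> 0 <= 1 - c * a j) ->
  v K <= beta1 ->
  (forall j, (K <= j)%N -> v j.+1 <= (1 - c * a j) * v j + beta2 * h j) ->
  (K <= k)%N ->
  v k <= beta1 * \prod_(K <= j < k) (1 - c * a j) +
    beta2 * \sum_(K <= i < k) h i * \prod_(i.+1 <= j < k) (1 - c * a j).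
Proof.
move=> ca_le1 vK vstep /subnK <-; elim: (k - K)%N => [|j IH].
  by rewrite add0n !big_geq// mulr1 mulr0 addr0.
rewrite addSn; set m := (j + K)%N in IH *.
have Km : (K <= m)%N by rewrite leq_addl.
apply: le_trans (vstep m Km) _.
apply: le_trans (lerD (ler_wpM2l (ca_le1 m Km) IH) (lexx _)) _.
have -> : \sum_(K <= i < m.+1) h i * \prod_(i.+1 <= j < m.+1) (1 - c * a j) =
    (1 - c * a m) * (\sum_(K <= i < m) h i * \prod_(i.+1 <= j < m) (1 - c * a j))
    + h m.
  rewrite big_nat_recr//= [X in _ + _ * X]big_geq// mulr1; congr (_ + _).
  rewrite mulr_sumr; apply: eq_big_nat => i /andP[_ im].
  by rewrite big_nat_recr//=; ring.
rewrite big_nat_recr//= le_eqVlt; apply/orP; left; apply/eqP; ring.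
Qed.

Theorem theorem2p1 (R : realType)
    (nX d : nat) (d_gt0 : (0 < d)%N) (XX : set 'rV[R]_nX) (x0 : XX)
    (P : R.-pker (state x0) ~> (state x0)) (mu : probability (state x0) R)
    (F : state x0 -> 'rV[R]_d -> 'rV[R]_d)
    (mF : forall theta : 'rV[R]_d, measurable_fun setT (F ^~ theta))
    (dO : measure_display) (Omega : measurableType dO)
    (Pr : probability Omega R)
    (X : nat -> {mfun Omega >-> state x0}) (w : nat -> {mfun Omega >-> 'rV[R]_d})
    (alpha : nat -> R) (alpha_gt0 : forall k, 0 < alpha k)
    (theta0 : 'rV[R]_d) (theta : nat -> Omega -> 'rV[R]_d)
    (theta_init : forall om, theta 0%N om = theta0)
    (theta_step : forall k om, theta k.+1 om =
       theta k om + alpha k *: (F (X k om) (theta k om) + w k om))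
    (X_markov : markov_chain P Pr (history theta X w) X)
    (L1 : R) (L1_gt0 : 0 < L1)
    (F_lip : forall x theta1 theta2,
       norm2 (F x theta1 - F x theta2) <= L1 * norm2 (theta1 - theta2))
    (F_bnd : forall x, norm2 (F x 0) <= L1)
    (thetas : 'rV[R]_d) (thetas_sol : mean_field mu F thetas = 0)
    (thetas_uniq : forall theta', mean_field mu F theta' = 0 -> theta' = thetas)
    (c0 : R) (c0_gt0 : 0 < c0)
    (F_diss : forall theta', dotv (theta' - thetas) (mean_field mu F theta') <=
       - c0 * norm2 (theta' - thetas) ^+ 2)
    (mu_stat : unique_stationary P mu)
    (C rho : R) (C_ge1 : 1 <= C) (rho_gt0 : 0 < rho) (rho_lt1 : rho < 1)
    (ergodic : forall k, (sup_tv P mu k <= (C * rho ^+ k)%:E)%E)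
    (w_mean0 : forall k,
       is_cond_exp_rV Pr (history theta X w k) (w k) (fun _ => 0))
    (L2 : R) (L2_gt0 : 0 < L2)
    (w_bnd : forall k,
       {ae Pr, forall om, norm2 (w k om) <= L2 * (norm2 (theta k om) + 1)}) :
  let L := L1 + L2 in
  let t k := mixing_time P mu (alpha k) in
  1 <= L ->
  (forall k, alpha k.+1 <= alpha k) ->
  alpha 0%N < 1 ->
  (* alpha_0 is below the precision of the chain at time 0; otherwise K = 0, all
     relevant stepsize windows may be empty, and the bound fails. *)
  (0 < t 0%N)%N ->
  (forall k, (t k <= k)%N -> alpha_window alpha t k < c0 / (130 * L ^+ 2)) ->
  forall K, is_least [set k | (t k <= k)%N] K ->
  let beta1 := (norm2 theta0 + norm2 (theta0 - thetas) + 1) ^+ 2 in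
  let beta2 := 130 * L ^+ 2 * (norm2 thetas + 1) ^+ 2 in
  let alphahat i := alpha i * alpha_window alpha t i in
  forall k, (K <= k)%N ->
    ('E_Pr[fun om => (norm2 (theta k om - thetas) ^+ 2)%R] <=
     (beta1 * \prod_(K <= j < k) (1 - c0 * alpha j) +
      beta2 * \sum_(K <= i < k)
        alphahat i * \prod_(i.+1 <= j < k) (1 - c0 * alpha j))%:E)%E.
Proof.
move=> L t L_ge1 alpha_dec alpha0_lt1 t0_gt0 window_lt K leastK beta1 beta2 alphahat k Kk.
(* A single null set [N] carries the exceptions for all times at once. *)
have /ae_foralln [N [mN N0 wN]] := w_bnd.
pose D := ~` N.
have mD : measurable D by exact: measurableC.
have D_conull : Pr (~` D) = 0%E by rewrite setCK.
have wD om : D om -> forall k, norm2 (w k om) <= L2 * (norm2 (theta k om) + 1).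
  by move=> Dom; apply: contrapT => nw; apply: Dom; apply: wN.
have mixes e : 0 < e -> exists j, (sup_tv P mu j <= e%:E)%E.
  exact: (geometric_mixing rho_gt0 rho_lt1 ergodic).
have c0L : c0 <= L.
  rewrite (@le_trans _ _ L1)//; last by rewrite lerDl ltW.
  exact: (dissipation_le_lipschitz mF L1_gt0 F_lip F_bnd d_gt0 thetas_sol F_diss).
have L_gt0 : 0 < L by rewrite (lt_le_trans ltr01).
have LL_gt0 : 0 < 130 * L ^+ 2 by rewrite mulr_gt0// exprn_gt0.
have smallE M : M < c0 / (130 * L ^+ 2) -> 130 * L ^+ 2 * M <= c0.
  by rewrite ltr_pdivlMr// mulrC => /ltW.
have small1 M : 130 * L ^+ 2 * M <= c0 -> 130 * (L * M) <= 1.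
  move=> /le_trans/(_ c0L); rewrite expr2 => LM.
  by rewrite -(ler_pM2l L_gt0); lra.
rewrite (@expectation_error _ _ _ _ F _ _ Pr X w alpha theta0 theta L1 L2 thetas D)//.
rewrite lee_fin.
pose v k := \int[Pr]_(om in D) norm2 (theta k om - thetas) ^+ 2.
apply: (@linear_recursion _ v alpha alphahat c0 beta1 beta2 K k _ _ _ Kk).
(* The contraction factor is nonnegative: [c0 * alpha j <= L * M <= 1 / 130]. *)
- move=> j Kj.
  have [s [e [M [_ _ _ _ [aM Mc _]]]]] :=
    admissible_lag alpha_gt0 alpha_dec mixes t0_gt0 window_lt leastK Kj.
  have LM := small1 _ (smallE _ Mc).
  have a0 := alpha_gt0 j.
  have : c0 * alpha j <= L * M by rewrite ler_pM ?(ltW c0_gt0) ?(ltW a0).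
  by lra.
- apply: (@mean_sq_error_init _ _ _ _ F _ _ Pr X w alpha theta0 theta L1 L2
    thetas D) => //.
  have := first_window_lt alpha_gt0 alpha_dec mixes window_lt leastK.
  by move=> /smallE/small1 => h; rewrite -/L; lra.
move=> j Kj.
have [s [e [M [sj tve eM WM [aM Mc Mw]]]]] :=
  admissible_lag alpha_gt0 alpha_dec mixes t0_gt0 window_lt leastK Kj.
have := mean_sq_error_step mF alpha_gt0 theta_init theta_step X_markov L1_gt0
  F_lip F_bnd F_diss w_mean0 L2_gt0 mD D_conull wD sj L_ge1 c0L tve eM WM aM
  (smallE _ Mc).
(* The lag bound [M] is at most the window in [alphahat j], also when the lag differs from [t j]. *)
move=> /le_trans; apply; rewrite lerD2l /beta2 /alphahat.
rewrite ler_wpM2l// ?ler_wpM2l ?(ltW (alpha_gt0 j))//.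
by rewrite mulr_ge0 ?sqr_ge0// ltW.
Qed.
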